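(* Let $l\ge 2$ be an integer. (i) Let $\lambda>\lambda_l$ and let $\mathfrak N$ be a $\lambda$-lacunary sequence of positive integers. Then the functions $\{e^{imx}:\ m\in\mathfrak N(l)\}$ form an unconditional convergence system. Namely, for any complex coefficients with $\sum_{m\in\mathfrak N(l)}|c_m|^2<\infty$ and any increasing sequence of finite sets of integers $G_1\subset G_2\subset\cdots\subset\mathfrak N(l)$, the sums $$\sum_{m\in G_n}c_m e^{imx},\qquad n=1,2,\ldots,$$ converge for almost every $x$ as $n\to\infty$. (ii) Conversely, $\lambda_l$ is critical: there exist a sequence of positive integers $\mathfrak N=\{n_k\}_{k\ge1}$ with $n_{k+1}/n_k>\lambda_l$ for all $k$, complex coefficients $c_m$, $m\in\mathfrak N(l)$, with $\sum_{m\in\mathfrak N(l)}|c_m|^2<\infty$, and an increasing sequence of finite sets $G_1\subset G_2\subset\cdots\subset\mathfrak N(l)$ such that the sums $\sum_{m\in G_n}c_m e^{imx}$ diverge for almost every $x$ as $n\to\infty$.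
   Context: For an integer $l\ge 3$, $\lambda_l$ is the unique solution $x>1$ of $x^{l-1}=x^{l-2}+x^{l-3}+\dots+1$; for $l=2$, $\lambda_2=1$. For $\lambda>1$, a sequence of positive integers $\{n_k\}_{k\ge 1}$ is $\lambda$-lacunary if $n_{k+1}/n_k>\lambda$ for all $k\ge1$. For $\mathfrak N=\{n_k\}_{k\ge1}$, $\mathfrak N(l)$ is the set of all integers $m\in\mathbb Z$ that can be written as $m=\varepsilon_1 n_{k_1}+\dots+\varepsilon_l n_{k_l}$ with $\varepsilon_j\in\{1,-1\}$ and indices $k_1>k_2>\dots>k_l\ge 1$. A countable orthogonal system $\{\phi_n\}$ of square-integrable functions is an unconditional convergence system if, whenever $\sum_n|a_n|^2<\infty$, the series $\sum_n a_n\phi_n(x)$ converges almost everywhere after any rearrangement of its terms. *)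

(* Defs.v *)
From HB Require Import structures.
From mathcomp Require Import all_boot all_order all_algebra finmap.
From mathcomp Require Import all_classical all_reals all_analysis.
From mathcomp Require Export complex.

Set Implicit Arguments.
Unset Strict Implicit.
Unset Printing Implicit Defensive.

Import Order.TTheory GRing.Theory Num.Theory.
Import numFieldNormedType.Exports.

Local Open Scope classical_set_scope.
Local Open Scope ring_scope.
Local Open Scope complex_scope.

Notation normc := ComplexField.Normc.normc.

Section critical_ratio.
Variable R : realType.

Definition critical_eq (l : nat) (x : R) : Prop :=
  1 < x /\ x ^+ l.-1 = \sum_(i < l.-1) x ^+ i.

(* For [l >= 3] the default value of [xget] is never used: see
   [critical_ratioP] and [critical_ratio_unique]. *)
Definition critical_ratio (l : nat) : R :=
  if (l <= 2)%N then 1 else xget 1 [set x | critical_eq l x].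

Lemma critical_eq_exists (l : nat) :
  (3 <= l)%N -> exists x : R, critical_eq l x.
Proof.
case: l => [|[|[|n]]] // _; rewrite /critical_eq /=.
pose p : {poly R} := 'X^(n.+2) - \sum_(i < n.+2) 'X^i.
have pE x : p.[x] = x ^+ n.+2 - \sum_(i < n.+2) x ^+ i.
  rewrite /p hornerD hornerN hornerXn horner_sum.
  by congr (_ - _); apply: eq_bigr => i _; rewrite hornerXn.
have p1 : p.[1] < 0.
  rewrite pE expr1n (eq_bigr (fun=> 1)) => [|i _]; last by rewrite expr1n.
  by rewrite sumr_const card_ord subr_lt0 (ltr_nat R 1).
have p2 : 0 < p.[2].
  rewrite pE; suff -> : \sum_(i < n.+2) 2 ^+ i = 2 ^+ n.+2 - 1 :> R.
    by rewrite opprB addrCA subrr addr0.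
  by rewrite subrX1 -natr1 addrK mul1r.
have [x /andP[x1 _] /rootP px] : exists2 x : R, 1 <= x <= 2 & root p x.
  apply: poly_ivt; first exact: (ler_nat R 1 2).
  by rewrite !ltW.
exists x; split; last by apply/eqP; rewrite -subr_eq0 -pE px.
rewrite lt_neqAle x1 andbT; apply/eqP => x1E.
by rewrite x1E px ltxx in p1.
Qed.

Lemma critical_eq_lt (l : nat) (x y : R) :
  (3 <= l)%N -> critical_eq l x -> critical_eq l y -> ~ x < y.
Proof.
case: l => [|[|[|n]]] // _ [x1 Ex] [y1 Ey] /= xy.
have x0 : 0 < x by exact: lt_trans ltr01 x1.
have q1 : 1 < y / x by rewrite ltr_pdivlMr // mul1r.
have yE : y = y / x * x by rewrite divfK // gt_eqF.
have : y ^+ n.+2 < y ^+ n.+2; last by rewrite ltxx.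
rewrite {1}Ey {2}yE exprMn Ex mulr_sumr.
apply: ltr_sum => [|i _].
  by apply/hasP; exists ord0; rewrite ?mem_index_enum.
by rewrite {1}yE exprMn ltr_pM2r ?exprn_gt0 // ltr_eXn2l.
Qed.

Lemma critical_ratioP (l : nat) :
  (3 <= l)%N -> critical_eq l (critical_ratio l).
Proof.
move=> l3; rewrite /critical_ratio leqNgt l3 /=.
have ex := critical_eq_exists l3.
exact: (@xgetPex _ 1 [set x | critical_eq l x] ex).
Qed.

Lemma critical_ratio_unique (l : nat) (x : R) :
  (3 <= l)%N -> critical_eq l x -> x = critical_ratio l.
Proof.
move=> l3 Hx; have Hy := critical_ratioP l3.
case: (ltgtP x (critical_ratio l)) => // xy.
- by case: (critical_eq_lt l3 Hx Hy xy).
- by case: (critical_eq_lt l3 Hy Hx xy).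
Qed.

End critical_ratio.

(* [lam = 1] is allowed, since the critical value for [l = 2] is 1. *)
Definition lacunary (R : realType) (lam : R) (n : nat -> nat) : Prop :=
  (forall k, (0 < n k)%N) /\ (forall k, lam < (n k.+1)%:R / (n k)%:R).

(* The set N(l); the sequence is indexed from 0. *)
Definition signed_sums (n : nat -> nat) (l : nat) : set int :=
  [set m | exists (eps : 'I_l -> int) (k : 'I_l -> nat),
    [/\ forall j, eps j = 1 \/ eps j = -1,
        forall i j : 'I_l, (i < j)%N -> (k j < k i)%N
      & m = \sum_(j < l) eps j * (n (k j))%:Z]].

Definition expi (R : realType) (t : R) : R[i] := cos t +i* sin t.

(* The library puts no topology on [R[i]] itself; it is obtained by viewing
   [R[i]] as a [numFieldType] with the modulus as norm. *)
Definition ccvg (R : realType) (u : nat -> R[i]) : Prop :=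
  exists z : (R[i] : numFieldType),
    (u : nat -> (R[i] : numFieldType)) @ \oo --> z.

Definition square_summable (R : realType) (I : choiceType) (A : set I)
    (c : I -> R[i]) : Prop :=
  (\esum_(i in A) (normc (c i) ^+ 2)%:E < +oo)%E.

Section systems.
Variables (R : realType) (d : measure_display) (T : measurableType d).
Variables (mu : {measure set T -> \bar R}) (D : set T).

Definition square_integrable (f : T -> R[i]) : Prop :=
  [/\ measurable_fun D (fun x => complex.Re (f x)),
      measurable_fun D (fun x => complex.Im (f x))
    & mu.-integrable D (fun x => (normc (f x) ^+ 2)%:E)].

Definition Cintegral (f : T -> R[i]) : R[i] :=
  Rintegral mu D (fun x => complex.Re (f x)) +i*
  Rintegral mu D (fun x => complex.Im (f x)).

Definition orthogonal_system (I : choiceType) (A : set I)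
    (phi : I -> T -> R[i]) : Prop :=
  (forall i, A i -> square_integrable (phi i)) /\
  (forall i j, A i -> A j -> i <> j ->
    Cintegral (fun x => phi i x * (phi j x)^*) = 0).

(* A rearrangement is an enumeration of the index set without repetition.
   There is none when [A] is finite, in which case every series over [A] is a
   finite sum and there is nothing to require. *)
Definition unconditional_convergence_system (I : choiceType) (A : set I)
    (phi : I -> T -> R[i]) : Prop :=
  [/\ countable A, orthogonal_system A phi &
    forall a : I -> R[i], square_summable A a ->
    forall s : nat -> I, set_bij [set: nat] A s ->
    {ae mu, forall x, D x ->
      ccvg (fun N => \sum_(k < N) a (s k) * phi (s k) x)}].

End systems.

(* The partial sum over [G] at [x] of the trigonometric series with
   coefficients [c]. *)
Definition trig_sum (R : realType) (c : int -> R[i]) (G : {fset int}) (x : R)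
    : R[i] :=
  \sum_(m <- G) c m * expi (m%:~R * x).

Definition increasing_in (A : set int) (G : nat -> {fset int}) : Prop :=
  (forall k, (G k `<=` G k.+1)%fset) /\
  (forall k (m : int), m \in G k -> A m).

(* Main.v *)
(* (i) By induction on l, N(l) is a Lambda(4) set: since lam > lambda_l, the
   element with top index k has modulus comparable to n_k, so after splitting the
   top indices into residue classes modulo a large q, the blocks with a fixed top
   index are so separated that in |F + P|^4 (F the sum of the lower blocks, P the
   new block) the term linear in P has mean 0; the remaining terms are controlled
   by the L^4 bound on P, which is a sum of two translates of N(l - 1).  The
   maximal inequality for L^4 follows by bisection of the total mass, and gives
   almost everywhere convergence.

   (ii) A sequence of ratio just above lambda_l can satisfy
   n_k - n_{k-1} - ... - n_{k-l+1} = m for every large integer m, so it is enough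
   to find divergent trigonometric sums with arbitrary large frequencies.  On a
   binary tree put the functions w_j(x) exp(i M_j x), where the weight w_j is a
   trigonometric polynomial close to the indicator of the set of x whose path
   passes through the node j, the path turning right at j when cos(M_j x) > 0.
   The M_j grow so fast that the angles M_j x are independent as far as the means
   of the polynomials used are concerned.  In the in-order arrangement of the
   nodes, the partial sum up to the leaf of x collects the right turns of x, and
   is of order N for a tree of depth N, while the L^2 norm is at most sqrt N. *)

(* An L^2 bound alone gives a maximal inequality only with a logarithmic loss. The L^4 bound is
   quadratic in the mass: halving the mass divides it by 4, so two halves cost half of the whole,
   and bisection closes with no loss. The bound does not see the order of the frequencies, hence the
   unconditional convergence. The critical ratio enters (i) only through lam^-1 + ... + lam^-(l-1) <
   1, which is its defining equation divided by x^(l-1) and turned into an inequality. It says that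
   the terms below the top one cannot cancel it. At equality they can, up to rounding, and (ii) is
   built on this cancellation. The obstacle in (ii) is that sharp decisions at the nodes would give
   indicators, which are not trigonometric polynomials. Softening a decision g in {0, 1} to g in
   [0, 1] costs w g (1 - g) at a node of weight w, multiplied by the depth N. The softening is
   therefore chosen after N. A single tree only gives a large partial sum off a small set; trees of
   mass 2^-(s+1) are then placed one after the other at increasing frequencies. *)
Require Import Defs.
From HB Require Import structures.
From mathcomp Require Import all_boot all_order all_algebra finmap.
From mathcomp Require Import all_classical all_reals all_analysis.
From mathcomp Require Import ring lra zify.

Import Order.TTheory GRing.Theory Num.Theory.
Import numFieldNormedType.Exports.

Local Open Scope classical_set_scope.
Local Open Scope ring_scope.
Local Open Scope complex_scope.

Set Implicit Arguments.
Unset Strict Implicit.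

(** * Means over a period *)

Section real_continuity.
Variable R : realType.
Implicit Types f g : R -> R.

Lemma contD f g : continuous f -> continuous g -> continuous (fun x => f x + g x).
Proof. by move=> cf cg x; apply: cvgD; [exact: cf|exact: cg]. Qed.

Lemma contN f : continuous f -> continuous (fun x => - f x).
Proof. by move=> cf x; apply: cvgN; exact: cf. Qed.

Lemma contM f g : continuous f -> continuous g -> continuous (fun x => f x * g x).
Proof. by move=> cf cg x; apply: cvgM; [exact: cf|exact: cg]. Qed.

Lemma contX f n : continuous f -> continuous (fun x => f x ^+ n).
Proof.
move=> cf; elim: n => [|n IH]; first by move=> x; exact: cvg_cst.
by under eq_fun do rewrite exprS; exact: contM.
Qed.

Lemma cont_cst (k : R) : continuous (fun _ : R => k).
Proof. by move=> x; exact: cvg_cst. Qed.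

Lemma contZ (k : R) f : continuous f -> continuous (fun x => k * f x).
Proof. by move=> cf; apply: contM => //; exact: cont_cst. Qed.

Lemma cont_sum (I : Type) (s : seq I) (P : pred I) (F : I -> R -> R) :
  (forall i, continuous (F i)) -> continuous (fun x => \sum_(i <- s | P i) F i x).
Proof.
move=> cF; elim: s => [|i s IH].
  by under eq_fun do rewrite big_nil; exact: cont_cst.
under eq_fun do rewrite big_cons.
by case: (P i) => //; apply: contD.
Qed.

Lemma cont_sum_seq (I : eqType) (s : seq I) (F : I -> R -> R) :
  {in s, forall i, continuous (F i)} -> continuous (fun x => \sum_(i <- s) F i x).
Proof.
move=> cF; pose G i x := if i \in s then F i x else 0.
have -> : (fun x => \sum_(i <- s) F i x) = (fun x => \sum_(i <- s) G i x).
  by apply/funext => x; rewrite big_seq [RHS]big_seq; apply: eq_bigr => i; rewrite /G => ->.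
apply: cont_sum => i; rewrite /G; have [/cF//|_] := boolP (i \in s); exact: cont_cst.
Qed.

Lemma cont_cosM (k : R) : continuous (fun x => cos (k * x)).
Proof.
move=> x; apply: (@continuous_comp _ _ _ (fun x => k * x) cos).
  by apply: contZ; move=> y; exact: cvg_id.
exact: continuous_cos.
Qed.

Lemma cont_sinM (k : R) : continuous (fun x => sin (k * x)).
Proof.
move=> x; apply: (@continuous_comp _ _ _ (fun x => k * x) sin).
  by apply: contZ; move=> y; exact: cvg_id.
exact: continuous_sin.
Qed.

Lemma cont_max f g : continuous f -> continuous g ->
  continuous (fun x => Num.max (f x) (g x)).
Proof. by move=> cf cg x; exact: (continuous_max (cf x) (cg x)). Qed.

Lemma cont_bigmax (I : Type) (s : seq I) (F : I -> R -> R) :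
  (forall i, continuous (F i)) -> continuous (fun x => \big[Num.max/0]_(i <- s) F i x).
Proof.
move=> cF; elim: s => [|i s IH].
  by under eq_fun do rewrite big_nil; exact: cont_cst.
by under eq_fun do rewrite big_cons; exact: cont_max.
Qed.

End real_continuity.

Section mean.
Variable R : realType.
Implicit Types (a : R) (f g F : R -> R).

(** The base point [a] stays free because the estimates are wanted on every period: the line has
    infinite measure, and [negligible_periods] glues the periods together. *)
Definition mean a f : R :=
  (2 * pi)^-1 * \int[@lebesgue_measure R]_(x in `[a, a + 2 * pi]) f x.

Let twopi_gt0 : 0 < 2 * pi :> R.
Proof. by rewrite mulr_gt0 ?pi_gt0. Qed.

Lemma continuous_integrable_itv a b f : continuous f ->
  (@lebesgue_measure R).-integrable `[a, b] (EFin \o f).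
Proof.
move=> cf; apply: continuous_compact_integrable; first exact: segment_compact.
exact: continuous_subspaceT.
Qed.

Lemma meanD a f g : continuous f -> continuous g ->
  mean a (fun x => f x + g x) = mean a f + mean a g.
Proof.
move=> cf cg; rewrite /mean -mulrDr; congr (_ * _).
by apply: RintegralD => //; exact: continuous_integrable_itv.
Qed.

Lemma meanZ a (k : R) f : continuous f -> mean a (fun x => k * f x) = k * mean a f.
Proof.
move=> cf; rewrite /mean mulrCA; congr (_ * _).
by apply: RintegralZl => //; exact: continuous_integrable_itv.
Qed.

Lemma mean_cst a (k : R) : mean a (fun=> k) = k.
Proof.
rewrite /mean Rintegral_cst//= lebesgue_measure_itv/= lte_fin ltrDl twopi_gt0/=.
have -> : a + 2 * pi - a = 2 * pi by ring.
by rewrite mulrCA mulVf ?mulr1// gt_eqF.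
Qed.

Lemma le_mean a f g : continuous f -> continuous g ->
  (forall x, f x <= g x) -> mean a f <= mean a g.
Proof.
move=> cf cg fg; apply: ler_wpM2l; first by rewrite invr_ge0 ltW.
by apply: le_Rintegral => //; exact: continuous_integrable_itv.
Qed.

Lemma eq_mean a f g : f =1 g -> mean a f = mean a g.
Proof. by move=> /funext ->. Qed.

Lemma mean_ge0 a f : (forall x, 0 <= f x) -> 0 <= mean a f.
Proof.
move=> f0; apply: mulr_ge0; first by rewrite invr_ge0 ltW.
exact: Rintegral_ge0.
Qed.

Lemma mean_sum a (I : Type) (s : seq I) (P : pred I) (F : I -> R -> R) :
  (forall i, continuous (F i)) ->
  mean a (fun x => \sum_(i <- s | P i) F i x) = \sum_(i <- s | P i) mean a (F i).
Proof.
move=> cF; elim: s => [|i s IH].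
  by rewrite big_nil -[RHS](mean_cst a 0); apply: eq_mean => x; rewrite big_nil.
rewrite big_cons -IH; case: ifPn => Pi; last first.
  by apply: eq_mean => x; rewrite big_cons (negbTE Pi).
rewrite -meanD//; last exact: cont_sum.
by apply: eq_mean => x; rewrite big_cons Pi.
Qed.

Lemma mean_sum_seq a (I : eqType) (s : seq I) (F : I -> R -> R) :
  {in s, forall i, continuous (F i)} ->
  mean a (fun x => \sum_(i <- s) F i x) = \sum_(i <- s) mean a (F i).
Proof.
move=> cF; pose G i x := if i \in s then F i x else 0.
have FG i : i \in s -> F i = G i by move=> is_; apply/funext => x; rewrite /G is_.
transitivity (mean a (fun x => \sum_(i <- s) G i x)).
  apply: eq_mean => x; rewrite big_seq [RHS]big_seq.
  by apply: eq_bigr => i /FG ->.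
rewrite mean_sum => [|i]; last first.
  by rewrite /G; have [/cF//|_] := boolP (i \in s); exact: cont_cst.
by rewrite big_seq [RHS]big_seq; apply: eq_bigr => i /FG ->.
Qed.

Lemma mean_derive a F f : (forall x : R, is_derive x (1 : R) F (f x)) -> continuous f ->
  F (a + 2 * pi) = F a -> mean a f = 0.
Proof.
move=> dF cf Fa; rewrite /mean /Rintegral.
have cF : continuous F.
  by move=> x; apply: differentiable_continuous; apply/derivable1_diffP; case: (dF x).
rewrite (@continuous_FTC2 _ _ F)//.
- by rewrite Fa subee// mulr0.
- by rewrite ltrDl.
- exact: continuous_subspaceT.
- split => [x _||].
  + by case: (dF x).
  + by apply: cvg_at_right_filter; exact: cF.
  + by apply: cvg_at_left_filter; exact: cF.
- by move=> x _; rewrite derive1E; case: (dF x).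
Qed.

Lemma markov_mean a f (e : R) : continuous f -> (forall x, 0 <= f x) -> 0 < e ->
  (lebesgue_measure (`[a, (a + 2 * pi)%R] `&` [set x | (e <= f x)%R])
     <= (2 * pi * (mean a f / e))%:E)%E.
Proof.
move=> cf f0 e0.
have mD : measurable (`[a, a + 2 * pi] : set R) by [].
have intf := continuous_integrable_itv a (a + 2 * pi) cf.
have mf := measurable_int _ intf.
have := le_integral_abse lebesgue_measure mD mf e0.
under eq_integral do rewrite /= ger0_norm ?f0//.
have -> : [set x | (e%:E <= `|(EFin \o f) x|)%E] = [set x | e <= f x].
  by apply/seteqP; split => x /=; rewrite lee_fin ger0_norm ?f0.
rewrite -(@fineK _ (\int[_]_(x in _) _)); last exact: integrable_fin_num intf.
have -> : fine (\int[lebesgue_measure]_(x in `[a, (a + 2 * pi)%R]) (f x)%:E) =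
    2 * pi * mean a f.
  by rewrite /mean mulrA mulfV ?mul1r// gt_eqF.
rewrite -lee_pdivlMl// => /le_trans; apply.
by rewrite -EFinM lee_fin mulrCA [_ * e^-1]mulrC.
Qed.

End mean.

(** * Trigonometric polynomials *)

Section trigonometric.
Variable R : realType.
Implicit Types (a x y : R) (z w : R[i]) (m k : int) (f g : R -> R[i]).

Local Notation Re := complex.Re.
Local Notation Im := complex.Im.

Definition nq z : R := Re z ^+ 2 + Im z ^+ 2.

Lemma sqr_normc_nq z : normc z ^+ 2 = nq z.
Proof. by case: z => u v; rewrite /nq /= sqr_sqrtr// addr_ge0 ?sqr_ge0. Qed.

Lemma nq_ge0 z : 0 <= nq z.
Proof. by rewrite addr_ge0 ?sqr_ge0. Qed.

Lemma nqM z w : nq (z * w) = nq z * nq w.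
Proof. by case: z w => [u v] [u' v']; rewrite /nq /=; ring. Qed.

Lemma nqN z : nq (- z) = nq z.
Proof. by case: z => u v; rewrite /nq /= !sqrrN. Qed.

Lemma nq0 : nq 0 = 0.
Proof. by rewrite /nq /= !expr0n /= addr0. Qed.

Lemma nqC (r : R) : nq r%:C = r ^+ 2.
Proof. by rewrite /nq /= expr0n addr0. Qed.

Lemma nqE z : (nq z)%:C = z * z^*.
Proof.
by case: z => u v; rewrite /nq; apply/eqP; rewrite eq_complex /=; apply/andP; split; apply/eqP; ring.
Qed.

Lemma ReD z w : Re (z + w) = Re z + Re w. Proof. by case: z w => ? ? []. Qed.
Lemma ImD z w : Im (z + w) = Im z + Im w. Proof. by case: z w => ? ? []. Qed.

Lemma Re_sum (I : Type) (s : seq I) (P : pred I) (F : I -> R[i]) :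
  Re (\sum_(i <- s | P i) F i) = \sum_(i <- s | P i) Re (F i).
Proof. by elim/big_rec2: _ => //= i u v _ <-; rewrite ReD. Qed.

Lemma Im_sum (I : Type) (s : seq I) (P : pred I) (F : I -> R[i]) :
  Im (\sum_(i <- s | P i) F i) = \sum_(i <- s | P i) Im (F i).
Proof. by elim/big_rec2: _ => //= i u v _ <-; rewrite ImD. Qed.

Lemma nqD_le (d : R) z w : 0 < d ->
  nq (z + w) <= (1 + d) * nq z + (1 + d^-1) * nq w.
Proof.
move=> d0; rewrite /nq ReD ImD.
have H (u v : R) : (u + v) ^+ 2 <= (1 + d) * u ^+ 2 + (1 + d^-1) * v ^+ 2.
  rewrite -subr_ge0.
  have -> : (1 + d) * u ^+ 2 + (1 + d^-1) * v ^+ 2 - (u + v) ^+ 2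
    = d^-1 * (d * u - v) ^+ 2 by field; rewrite gt_eqF.
  by rewrite mulr_ge0 ?sqr_ge0// invr_ge0 ltW.
have := H (Re z) (Re w); have := H (Im z) (Im w); lra.
Qed.

(** Convexity of the fourth power with weights 1/(1+d) and d/(1+d). A small [d] keeps the factor of
    the first term near 1, which the bisection relies on. *)
Lemma nq2D_le (d : R) z w : 0 < d ->
  nq (z + w) ^+ 2 <= (1 + d) ^+ 3 * nq z ^+ 2 + (1 + d^-1) ^+ 3 * nq w ^+ 2.
Proof.
move=> d0; have Hd := nqD_le z w d0.
have d1 : 0 < d^-1 by rewrite invr_gt0.
set u := nq z in Hd *; set v := nq w in Hd *.
have u0 : 0 <= u := nq_ge0 _; have v0 : 0 <= v := nq_ge0 _.
apply: (@le_trans _ _ (((1 + d) * u + (1 + d^-1) * v) ^+ 2)).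
  by rewrite lerXn2r ?nnegrE ?nq_ge0// (le_trans _ Hd) ?nq_ge0.
rewrite -subr_ge0.
have -> : (1 + d) ^+ 3 * u ^+ 2 + (1 + d^-1) ^+ 3 * v ^+ 2 -
    ((1 + d) * u + (1 + d^-1) * v) ^+ 2 =
    d^-1 * (d * (1 + d) * u - (1 + d^-1) * v) ^+ 2.
  by field; rewrite gt_eqF.
by rewrite mulr_ge0 ?sqr_ge0 ?ltW.
Qed.

Lemma periodic_intM (h : R -> R) (t : R) m x : periodic h t -> h (x + t *~ m) = h x.
Proof.
move=> ht; case: m => n; first exact: periodicn.
by rewrite NegzE mulrNz -(periodicn ht n.+1 (x + _)) -addrA addNr addr0.
Qed.

Lemma expiD x y : expi (x + y) = expi x * expi y.
Proof.
rewrite /expi cosD sinD; apply/eqP; rewrite eq_complex /=; apply/andP; split=> //.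
by apply/eqP; ring.
Qed.

Lemma expi0 : expi (0 : R) = 1.
Proof. by rewrite /expi cos0 sin0. Qed.

Lemma expiN x : expi (- x) = (expi x)^*.
Proof. by rewrite /expi cosN sinN. Qed.

Lemma nq_expi x : nq (expi x) = 1.
Proof. by rewrite /nq /= cos2Dsin2. Qed.

Lemma expiMD m k x : expi ((m + k)%:~R * x) = expi (m%:~R * x) * expi (k%:~R * x).
Proof. by rewrite intrD mulrDl expiD. Qed.

Lemma expiMN m x : expi ((- m)%:~R * x) = (expi (m%:~R * x))^*.
Proof. by rewrite intrN mulNr expiN. Qed.

Lemma mean_cosM a m : m != 0 -> mean a (fun x => cos (m%:~R * x)) = 0.
Proof.
move=> m0; have m0R : (m%:~R : R) != 0 by rewrite intr_eq0.
apply: (@mean_derive _ a (fun x => (m%:~R)^-1 * sin (m%:~R * x))).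
- move=> x; have H : is_derive x (1 : R) (fun x : R => (m%:~R : R) * x) m%:~R.
    apply: is_derive_eq; rewrite /GRing.scale /= mulr1 ?mulr0 ?addr0//.
  apply: is_derive_eq.
  by rewrite /GRing.scale /=; field.
- exact: cont_cosM.
- congr (_ * _).
  have -> : m%:~R * (a + 2 * pi) = m%:~R * a + (pi *+ 2) *~ m :> R.
    by rewrite -[in RHS]mulrzr; ring.
  by apply: periodic_intM; exact: sinD2pi.
Qed.

Lemma mean_sinM a m : mean a (fun x => sin (m%:~R * x)) = 0.
Proof.
have [->|m0] := eqVneq m 0.
  by rewrite -[RHS](mean_cst a 0); apply: eq_mean => x; rewrite mul0r sin0.
have m0R : (m%:~R : R) != 0 by rewrite intr_eq0.
apply: (@mean_derive _ a (fun x => - (m%:~R)^-1 * cos (m%:~R * x))).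
- move=> x; have H : is_derive x (1 : R) (fun x : R => (m%:~R : R) * x) m%:~R.
    apply: is_derive_eq; rewrite /GRing.scale /= mulr1 ?mulr0 ?addr0//.
  apply: is_derive_eq.
  by rewrite /GRing.scale /=; field.
- exact: cont_sinM.
- congr (_ * _).
  have -> : m%:~R * (a + 2 * pi) = m%:~R * a + (pi *+ 2) *~ m :> R.
    by rewrite -[in RHS]mulrzr; ring.
  by apply: periodic_intM; exact: cosD2pi.
Qed.

Lemma cont_Re_term z m : continuous (fun x => Re (z * expi (m%:~R * x))).
Proof.
case: z => u v.
have -> : (fun x => Re ((u +i* v) * expi (m%:~R * x))) =
   (fun x => u * cos (m%:~R * x) + (- v) * sin (m%:~R * x)).
  by apply/funext => x /=; rewrite mulNr.
by apply: contD; apply: contZ; [exact: cont_cosM|exact: cont_sinM].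
Qed.

Lemma cont_Im_term z m : continuous (fun x => Im (z * expi (m%:~R * x))).
Proof.
case: z => u v.
have -> : (fun x => Im ((u +i* v) * expi (m%:~R * x))) =
   (fun x => u * sin (m%:~R * x) + v * cos (m%:~R * x)).
  by apply/funext => x /=.
by apply: contD; apply: contZ; [exact: cont_sinM|exact: cont_cosM].
Qed.

Lemma mean_Re_term a z m :
  mean a (fun x => Re (z * expi (m%:~R * x))) = if m == 0 then Re z else 0.
Proof.
case: z => u v.
have -> : (fun x => Re ((u +i* v) * expi (m%:~R * x))) =
   (fun x => u * cos (m%:~R * x) + (- v) * sin (m%:~R * x)).
  by apply/funext => x /=; rewrite mulNr.
rewrite meanD; [|by apply: contZ; exact: cont_cosM|by apply: contZ; exact: cont_sinM].
rewrite !meanZ; [|exact: cont_sinM|exact: cont_cosM].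
rewrite mean_sinM mulr0 addr0; case: ifPn => [/eqP ->|m0]; last first.
  by rewrite mean_cosM ?mulr0.
under eq_mean do rewrite mul0r cos0.
by rewrite mean_cst mulr1.
Qed.

(** Frequencies may repeat in the list, which makes sums and products immediate; [tpoly_coef] merges
    them when coefficients are wanted. *)
Definition tpoly (A : set int) f := exists2 s : seq (R[i] * int),
  (forall p, p \in s -> A p.2) & forall x, f x = \sum_(p <- s) p.1 * expi (p.2%:~R * x).

Lemma tpolyS (A B : set int) f : A `<=` B -> tpoly A f -> tpoly B f.
Proof. by move=> AB [s sA fE]; exists s => // p /sA /AB. Qed.

Lemma eq_tpoly (A : set int) f g : f =1 g -> tpoly A f -> tpoly A g.
Proof. by move=> /funext ->. Qed.

Lemma tpoly0 (A : set int) : tpoly A (fun=> 0).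
Proof. by exists [::] => // x; rewrite big_nil. Qed.

Lemma tpoly1 (A : set int) z m : A m -> tpoly A (fun x => z * expi (m%:~R * x)).
Proof.
move=> Am; exists [:: (z, m)] => [p|x]; first by rewrite inE => /eqP ->.
by rewrite big_seq1.
Qed.

Lemma tpolyD (A : set int) f g : tpoly A f -> tpoly A g -> tpoly A (fun x => f x + g x).
Proof.
move=> [s sA fE] [t tA gE]; exists (s ++ t) => [p|x].
  by rewrite mem_cat => /orP[/sA|/tA].
by rewrite big_cat fE gE.
Qed.

Lemma tpoly_sum (A : set int) (I : eqType) (s : seq I) (F : I -> R -> R[i]) :
  (forall i, i \in s -> tpoly A (F i)) -> tpoly A (fun x => \sum_(i <- s) F i x).
Proof.
elim: s => [|i s IH] H.
  by apply: eq_tpoly (tpoly0 A) => x; rewrite big_nil.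
have := tpolyD (H i (mem_head _ _)) (IH (fun j js => H j (mem_behead (s := i :: s) js))).
by apply: eq_tpoly => x; rewrite big_cons.
Qed.

Lemma tpolyM (A B : set int) f g : tpoly A f -> tpoly B g ->
  tpoly [set m | exists u v, [/\ A u, B v & m = u + v]] (fun x => f x * g x).
Proof.
move=> [s sA fE] [t tB gE].
have H x : f x * g x = \sum_(p <- s) \sum_(q <- t)
    (p.1 * q.1) * expi ((p.2 + q.2)%:~R * x).
  rewrite fE gE big_distrl; apply: eq_bigr => p _.
  rewrite big_distrr; apply: eq_bigr => q _ /=.
  by rewrite expiMD mulrACA.
apply: (@eq_tpoly _ (fun x => \sum_(p <- s) \sum_(q <- t)
    (p.1 * q.1) * expi ((p.2 + q.2)%:~R * x))) => [x|]; first by rewrite H.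
apply: tpoly_sum => p ps; apply: tpoly_sum => q qt; apply: tpoly1.
by exists p.2, q.2; split; [exact: sA|exact: tB|].
Qed.

Lemma tpoly_conj (A : set int) f : tpoly A f ->
  tpoly [set m | A (- m)] (fun x => (f x)^*).
Proof.
move=> [s sA fE]; exists [seq ((p.1)^*, - p.2) | p <- s].
  by move=> p /mapP[q qs ->] /=; rewrite opprK; exact: sA.
move=> x; rewrite fE big_map rmorph_sum; apply: eq_bigr => p _ /=.
by rewrite expiMN; exact: rmorphM.
Qed.

Lemma tpolyZ (A : set int) z f : tpoly A f -> tpoly A (fun x => z * f x).
Proof.
move=> [s sA fE]; exists [seq (z * p.1, p.2) | p <- s].
  by move=> p /mapP[q qs ->] /=; exact: sA.
by move=> x; rewrite fE big_map mulr_sumr; apply: eq_bigr => p _; rewrite mulrA.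
Qed.

Lemma tpoly_contRe (A : set int) f : tpoly A f -> continuous (fun x => Re (f x)).
Proof.
move=> [s _ fE].
have -> : (fun x => Re (f x)) = (fun x => \sum_(p <- s) Re (p.1 * expi (p.2%:~R * x))).
  by apply/funext => x; rewrite fE Re_sum.
by apply: cont_sum => p; exact: cont_Re_term.
Qed.

Lemma tpoly_contIm (A : set int) f : tpoly A f -> continuous (fun x => Im (f x)).
Proof.
move=> [s _ fE].
have -> : (fun x => Im (f x)) = (fun x => \sum_(p <- s) Im (p.1 * expi (p.2%:~R * x))).
  by apply/funext => x; rewrite fE Im_sum.
by apply: cont_sum => p; exact: cont_Im_term.
Qed.

Lemma tpoly_contnq (A : set int) f : tpoly A f -> continuous (fun x => nq (f x)).
Proof.
move=> tf; apply: contD; apply: contX; [exact: tpoly_contRe tf|exact: tpoly_contIm tf].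
Qed.

Lemma mean_tpoly (A : set int) a f : tpoly A f -> ~ A 0 -> mean a (fun x => Re (f x)) = 0.
Proof.
move=> [s sA fE] A0.
under eq_mean do rewrite fE Re_sum.
rewrite mean_sum; last by move=> p; exact: cont_Re_term.
rewrite big_seq big1// => p ps; rewrite mean_Re_term.
by case: ifPn => // /eqP p0; case: A0; rewrite -p0; exact: sA.
Qed.

Lemma tpoly_trig_sum (A : set int) (c : int -> R[i]) (E : {fset int}) :
  (forall m, m \in E -> A m) -> tpoly A (trig_sum c E).
Proof.
move=> EA; apply: tpoly_sum => m mE; apply: tpoly1; exact: EA.
Qed.

Lemma parseval a (c : int -> R[i]) (E : {fset int}) :
  mean a (fun x => nq (trig_sum c E x)) = \sum_(m <- E) nq (c m).
Proof.
have H x : nq (trig_sum c E x) = \sum_(m <- E) \sum_(k <- E)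
    Re ((c m * (c k)^*) * expi ((m - k)%:~R * x)).
  have -> : nq (trig_sum c E x) = Re (trig_sum c E x * (trig_sum c E x)^*).
    by rewrite -nqE.
  rewrite /trig_sum rmorph_sum big_distrl Re_sum; apply: eq_bigr => m _.
  rewrite big_distrr Re_sum; apply: eq_bigr => k _ /=.
  by rewrite expiMD expiMN rmorphM mulrACA.
under eq_mean do rewrite H.
rewrite mean_sum; last by move=> m; apply: cont_sum => k; exact: cont_Re_term.
rewrite big_seq [RHS]big_seq; apply: eq_bigr => m mE.
rewrite mean_sum; last by move=> k; exact: cont_Re_term.
under eq_bigr do rewrite mean_Re_term subr_eq0.
rewrite (bigD1_seq m)//= eqxx big1 ?addr0; last first.
  by move=> k km; rewrite eq_sym (negbTE km).
by rewrite -nqE.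
Qed.

End trigonometric.

(** * The maximal inequality *)

Section complex_convergence.
Variable R : realType.
Implicit Type u : nat -> R[i].

Lemma normcE_nq (z : R[i]) : `|z| = (Num.sqrt (nq z))%:C.
Proof. by case: z. Qed.

Lemma ltr_normc_nq (z : R[i]) (e : R) : 0 < e -> (`|z| < e%:C) = (nq z < e ^+ 2).
Proof.
move=> e0; rewrite normcE_nq ltcR -[in LHS](ger0_norm (ltW e0)) -sqrtr_sqr.
by rewrite ltr_sqrt// exprn_gt0.
Qed.

Lemma ccvg_cauchy u (e : R) : 0 < e -> ccvg u ->
  exists N, forall m n, (N <= m)%N -> (N <= n)%N -> nq (u m - u n) < e.
Proof.
move=> e0 [z /cvgrPdist_lt uz].
have se0 : 0 < Num.sqrt (e / 4) by rewrite sqrtr_gt0 divr_gt0.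
have /uz : (0 : R[i]) < (Num.sqrt (e / 4))%:C by rewrite ltcR.
move=> [N _ HN]; exists N => m n Nm Nn.
have H k : (N <= k)%N -> nq (z - u k) < e / 4.
  by move=> /HN /=; rewrite ltr_normc_nq// sqr_sqrtr// ltW// divr_gt0.
have -> : u m - u n = - (z - u m) + (z - u n) by rewrite opprB addrA subrK.
apply: le_lt_trans (nqD_le _ _ (ltr01 : 0 < (1 : R))) _.
rewrite nqN invr1; have := H _ Nm; have := H _ Nn; lra.
Qed.

(** Comparison with the single term [u N] is the form that a maximal function controls. Real and
    imaginary parts are 1-Lipschitz for the modulus, so each is a real Cauchy sequence. *)
Lemma cauchy_ccvg u :
  (forall e : R, 0 < e -> exists N, forall n, (N <= n)%N -> nq (u n - u N) <= e) ->
  ccvg u.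
Proof.
move=> uC.
have Hc (h : R[i] -> R) : (forall z w, (h z - h w) ^+ 2 <= nq (z - w)) ->
    cvg (h \o u @ \oo).
  move=> hnq; apply/cauchy_cvgP; apply/cauchy_exP => e e0.
  have e2 : 0 < (e / 2) ^+ 2 by rewrite exprn_gt0 ?divr_gt0.
  have [N HN] := uC _ e2; exists (h (u N)).
  exists N => // n /= /HN Hn; rewrite /ball /=.
  have : `|h (u N) - h (u n)| <= e / 2.
    rewrite distrC -(@ler_pXn2r _ 2)// ?nnegrE ?divr_ge0 ?(ltW e0)//.
    by rewrite real_normK ?num_real// (le_trans (hnq _ _)).
  by move=> /le_lt_trans; apply; rewrite ltr_pdivrMr// mulr_natr mulr2n ltrDl.
have hR (z w : R[i]) : (complex.Re z - complex.Re w) ^+ 2 <= nq (z - w).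
  by case: z w => [a b] [c d]; rewrite /nq /= lerDl sqr_ge0.
have hI (z w : R[i]) : (complex.Im z - complex.Im w) ^+ 2 <= nq (z - w).
  by case: z w => [a b] [c d]; rewrite /nq /= lerDr sqr_ge0.
have := Hc _ hR; have := Hc _ hI.
set b := lim _ => /cvgrPdist_lt cb; set a := lim _ => /cvgrPdist_lt ca.
exists (a +i* b); apply/cvgrPdist_lt => e; rewrite ltcE /= => /andP[/eqP ei er].
have -> : e = (complex.Re e)%:C by move: ei; case: (e) => x y /= ->.
have e2 : 0 < complex.Re e / 2 by rewrite divr_gt0.
near=> n; rewrite ltr_normc_nq//.
have hh : (`|a - complex.Re (u n)| < complex.Re e / 2) && (`|b - complex.Im (u n)| < complex.Re e / 2).
  by apply/andP; split; near: n; [exact: ca|exact: cb].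
have sq (x y : R) : `|x| < y -> x ^+ 2 < y ^+ 2.
  move=> xy; rewrite -(real_normK (num_real x)) ltr_pXn2r// nnegrE.
  exact: le_trans (ltW xy).
move/andP: hh => [/sq h1 /sq h2].
have -> : nq ((a +i* b : R[i]) - u n) = (a - complex.Re (u n)) ^+ 2 + (b - complex.Im (u n)) ^+ 2.
  by case: (u n).
have := sqr_ge0 (complex.Re e); move: h1 h2; rewrite expr_div_n; nra.
Unshelve. all: by end_near.
Qed.

End complex_convergence.

Section maximal.
Variable R : realType.
Variables (S : nat -> R -> R[i]) (v : nat -> R) (C : R).
Hypothesis contS : forall i j, continuous (fun x => nq (S i x - S j x)).
Hypothesis v_nd : forall i j, (i <= j)%N -> v i <= v j.
Hypothesis C_ge0 : 0 <= C.
Hypothesis S_v : forall a i j, (i <= j)%N ->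
  mean a (fun x => nq (S j x - S i x) ^+ 2) <= C * (v j - v i) ^+ 2.

Definition maxdiff (p n : nat) (x : R) : R :=
  \big[Num.max/0]_(k < n.+1) (nq (S (p + k) x - S p x) ^+ 2).

Lemma cont_maxdiff p n : continuous (maxdiff p n).
Proof.
apply: (@cont_bigmax _ _ _ (fun (k : 'I_n.+1) x => nq (S (p + k) x - S p x) ^+ 2)) => k.
by apply: contX; exact: contS.
Qed.

Lemma maxdiff_ge0 p n x : 0 <= maxdiff p n x.
Proof. exact: bigmax_ge_id. Qed.

Lemma le_maxdiff p n k x : (k <= n)%N -> nq (S (p + k) x - S p x) ^+ 2 <= maxdiff p n x.
Proof.
rewrite -ltnS => kn.
exact: (le_bigmax _ (fun k : 'I_n.+1 => nq (S (p + k) x - S p x) ^+ 2) (Ordinal kn)).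
Qed.

(** Take the last [h] before which at most half of the mass has accumulated. The increment from
    [p + h] to [(p + h).+1] belongs to neither half and may exceed both. *)
Lemma half_mass p n : exists2 h, (h <= n)%N &
  v (p + h) - v p <= (v (p + n.+1) - v p) / 2 /\
  v (p + n.+1) - v (p + h).+1 <= (v (p + n.+1) - v p) / 2.
Proof.
set g := v (p + n.+1) - v p.
have g0 : 0 <= g by rewrite subr_ge0 v_nd// leq_addr.
pose P h := (h <= n)%N && (v (p + h) - v p <= g / 2).
have exP : exists h, P h by exists 0; rewrite /P addn0 subrr divr_ge0.
have ubP h : P h -> (h <= n)%N by case/andP.
case: (ex_maxnP exP ubP) => h /andP[hn hg] hmax; exists h => //; split=> //.
have [hn'|hn'] := ltnP h n.
  have : ~~ P h.+1 by apply/negP => /hmax; rewrite ltnn.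
  by rewrite /P hn' /= -ltNge addnS /g; lra.
have -> : h = n by apply/eqP; rewrite eqn_leq hn hn'.
by rewrite addnS subrr divr_ge0.
Qed.

(* Bisection of the total mass, after Moricz: [K = 1944 C] satisfies
   [K / 4 + (9/8)^3 * K / 4 + 9^3 * C <= K]. *)
Lemma mean_maxdiff a n p :
  mean a (maxdiff p n) <= 1944 * C * (v (p + n) - v p) ^+ 2.
Proof.
elim/ltn_ind: n p => -[_|n IH] p.
  rewrite addn0 subrr expr0n mulr0 (@eq_mean _ a _ (fun=> 0)) ?mean_cst// => x.
  apply/le_anti; rewrite maxdiff_ge0 andbT; apply: bigmax_le => // -[[|//] ?] _ /=.
  by rewrite addn0 subrr nq0 expr0n.
have [h hn [h1 h2]] := half_mass p n.
set g := v (p + n.+1) - v p in h1 h2 *.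
(* [q] lies just after the uncontrolled increment. The jump from [p] to [q] is a single difference,
   bounded by [S_v] without any maximum. *)
pose q := (p + h).+1.
have g0 : 0 <= g by rewrite subr_ge0 v_nd// leq_addr.
have qn : (q + (n - h) = p + n.+1)%N by rewrite /q; move: hn; clear; lia.
have pq : (p <= q)%N by rewrite /q; clear; lia.
have qpn : (q <= p + n.+1)%N by rewrite /q; move: hn; clear; lia.
have nh : (n - h < n.+1)%N by clear; lia.
have rest_ge0 x : 0 <= 729 / 512 * maxdiff q (n - h) x + 729 * nq (S q x - S p x) ^+ 2.
  apply: addr_ge0; apply: mulr_ge0; [|exact: maxdiff_ge0| |exact: sqr_ge0].
    by apply: divr_ge0; exact: ler0n.
  exact: ler0n.
have split_le x : maxdiff p n.+1 x <= maxdiff p h x +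
    (729 / 512 * maxdiff q (n - h) x + 729 * nq (S q x - S p x) ^+ 2).
  apply: bigmax_le => [|[k kn] _ /=].
    by apply: addr_ge0; [exact: maxdiff_ge0|exact: rest_ge0].
  have [kh|kh] := leqP k h.
    apply: (le_trans (le_maxdiff p x kh)); rewrite lerDl.
    exact: rest_ge0.
  apply: ler_wpDl; first exact: maxdiff_ge0.
  have -> : S (p + k) x - S p x = (S (q + (k - h.+1)) x - S q x) + (S q x - S p x).
    by rewrite addrA subrK; congr (S _ x - _); rewrite /q; move: kh; clear; lia.
  (* The recursion closes only if 1/4 + (1+d)^3/4 < 1, that is (1+d)^3 < 3; the choice d = 1/8
     satisfies this, d = 1 would not. *)
  have d0 : 0 < 8^-1 :> R by rewrite invr_gt0 ltr0n.
  apply: (le_trans (nq2D_le _ _ d0)).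
  have -> : (1 + 8^-1) ^+ 3 = 729 / 512 :> R by field.
  have -> : (1 + 8^-1^-1) ^+ 3 = 729 :> R by rewrite invrK; ring.
  rewrite lerD2r; apply: ler_wpM2l; first by apply: divr_ge0; exact: ler0n.
  by apply: le_maxdiff; move: kn; clear; lia.
have c1 := @cont_maxdiff p h; have c2 := @cont_maxdiff q (n - h).
have c3 : continuous (fun x => nq (S q x - S p x) ^+ 2) by apply: contX; exact: contS.
apply: (@le_trans _ _ (mean a (fun x => maxdiff p h x +
    (729 / 512 * maxdiff q (n - h) x + 729 * nq (S q x - S p x) ^+ 2)))).
  apply: le_mean => //; first exact: cont_maxdiff.
  by apply: contD => //; apply: contD; exact: contZ.
rewrite meanD//; last by apply: contD; exact: contZ.
rewrite meanD; [|exact: contZ|exact: contZ].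
rewrite !meanZ//.
have i1 := IH h hn p.
have i2 : mean a (maxdiff q (n - h)) <= 1944 * C * (v (p + n.+1) - v (p + h).+1) ^+ 2.
  by rewrite -qn; exact: IH.
have i3 : mean a (fun x => nq (S q x - S p x) ^+ 2) <= C * g ^+ 2.
  apply: (le_trans (S_v a pq)).
  apply: ler_wpM2l => //; rewrite lerXn2r ?nnegrE//.
  - by rewrite subr_ge0 v_nd.
  - by rewrite /g lerD2r v_nd.
have sq (x y : R) : 0 <= x -> x <= y / 2 -> C * x ^+ 2 <= C * y ^+ 2 / 4.
  move=> x0 xy; rewrite -mulrA; apply: ler_wpM2l => //.
  have -> : y ^+ 2 / 4 = (y / 2) ^+ 2 by field.
  by rewrite lerXn2r// nnegrE (le_trans x0 xy).
have s1 := sq _ _ _ h1; have s2 := sq _ _ _ h2.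
have {}s1 := s1 ltac:(by rewrite subr_ge0 v_nd// leq_addr).
have {}s2 := s2 ltac:(by rewrite subr_ge0 v_nd// addnS ltnS leq_add2l).
have Cg : 0 <= C * g ^+ 2 by rewrite mulr_ge0 ?sqr_ge0.
rewrite -mulrA in i1; rewrite -mulrA in i2; rewrite -mulrA.
move: i1 i2 i3 s1 s2 Cg.
set m1 := mean _ _; set m2 := mean _ _; set m3 := mean _ _; set t := C * g ^+ 2.
set t1 := C * _ ^+ 2; set t2 := C * _ ^+ 2.
clear; lra.
Qed.

End maximal.

(** * From the maximal inequality to almost everywhere convergence *)

Section almost_everywhere.
Variable R : realType.
Local Notation mu := (@lebesgue_measure R).

Lemma negligible_periods (N : set R) :
  (forall a : R, mu.-negligible (N `&` `[a, a + 2 * pi])) -> mu.-negligible N.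
Proof.
move=> H.
have sub : N `<=` (\bigcup_n (N `&` `[n%:R, n%:R + 2 * pi])) `|`
   (\bigcup_n (N `&` `[- n%:R, - n%:R + 2 * pi])).
  move=> x Nx.
  have pi1 : 1 <= 2 * pi :> R by have := pi_ge2 R; lra.
  have [x0|x0] := leP 0 x.
    left; exists (Num.truncn x) => //; split => //=.
    rewrite in_itv /= truncn_le//=.
    by have /andP[_] := truncn_itv x0; rewrite -natr1; lra.
  right; exists (Num.truncn (- x)).+1 => //; split => //=; rewrite in_itv /=.
  have nx0 : 0 <= - x by lra.
  by have /andP[] := truncn_itv nx0; rewrite -natr1; lra.
apply: (@negligibleS _ _ _ mu _ _ sub).
by apply: negligibleU; apply: negligible_bigcup => n; exact: H.
Qed.

Lemma measurable_superlevel (f : R -> R) (e : R) : continuous f ->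
  measurable [set x | e <= f x].
Proof.
move=> cf; apply: measurable_realfun.closed_measurable.
by apply: (@preimage_closed _ _ f [set y | e <= y]); [move=> x _; exact: cf|exact: closed_ge].
Qed.

Variables (S : nat -> R -> R[i]) (v : nat -> R) (C : R).
Hypothesis contS : forall i j, continuous (fun x => nq (S i x - S j x)).
Hypothesis v_nd : forall i j, (i <= j)%N -> v i <= v j.
Hypothesis v_bnd : exists B, forall i, v i <= B.
Hypothesis C_ge0 : 0 <= C.
Hypothesis S_v : forall a i j, (i <= j)%N ->
  mean a (fun x => nq (S j x - S i x) ^+ 2) <= C * (v j - v i) ^+ 2.

Lemma mass_tail (d : R) : 0 < d -> exists p, forall n, v (p + n) - v p <= d.
Proof.
move=> d0; have [B vB] := v_bnd.
have [p _ Hp] : exists2 p, True & forall n, v (p + n) - v p <= d; last by exists p.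
apply: contrapT => H.
have grow k : exists p, v 0 + k%:R * d <= v p.
  elim: k => [|k [p vp]]; first by exists 0; rewrite mul0r addr0.
  have [n Hn] : exists n, d < v (p + n) - v p.
    apply: contrapT => H2; apply: H; exists p => // n.
    by rewrite leNgt; apply/negP => H3; apply: H2; exists n.
  by exists (p + n); rewrite -natr1; lra.
have [p vp] := grow (Num.bound ((B - v 0) / d)).
have Bv0 : 0 <= (B - v 0) / d by rewrite divr_ge0 ?subr_ge0// ltW.
have := archi_boundP Bv0; rewrite ltr_pdivrMr// => Hlt.
have := vB p; lra.
Qed.

(** In a period, [U e p] is where the oscillation after [p] reaches [e]; its measure is at most a
    constant times d^2/e, with [d] the mass beyond [p]. A point of divergence lies, for some [e], in
    [U e p] for all [p], and this intersection [Z e] is null. *)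
Lemma ae_ccvg : {ae mu, forall x : R, ccvg (fun k => S k x)}.
Proof.
rewrite /almost_everywhere; apply: negligible_periods => a.
have [K K_ge0 meanK] : exists2 K : R, 0 <= K & forall n p,
    mean a (maxdiff S p n) <= K * (v (p + n) - v p) ^+ 2.
  by exists (1944 * C) => [|n p]; [rewrite mulr_ge0 ?ler0n|exact: mean_maxdiff].
pose I : set R := `[a, a + 2 * pi]%classic.
pose V e p n := I `&` [set x | e <= maxdiff S p n x].
have mV e p n : measurable (V e p n).
  apply: measurableI; [exact: measurable_itv|].
  exact: (measurable_superlevel e (@cont_maxdiff _ _ contS p n)).
pose U e p := \bigcup_n V e p n.
have mU e p : measurable (U e p) by apply: bigcup_measurable => n _; exact: mV.
have muU e p d : 0 < e -> (forall n, v (p + n) - v p <= d) ->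
    (mu (U e p) <= (2 * pi * (K * d ^+ 2 / e))%:E)%E.
  move=> e0 Hd.
  have cU : mu \o V e p @ \oo --> mu (U e p).
    apply: nondecreasing_cvg_mu; [by move=> n; exact: mV|exact: mU|].
    move=> m n mn; apply/subsetPset => x [Ix /= Hx].
    split => //=; apply: le_trans Hx _; apply: bigmax_le => [|[k km] _ /=].
      exact: maxdiff_ge0.
    by apply: le_maxdiff; rewrite -ltnS (leq_trans km).
  apply: cvge_to_le cU _; near=> n => /=.
  apply: le_trans (markov_mean a (@cont_maxdiff _ _ contS p n) (maxdiff_ge0 S p n) e0) _.
  rewrite lee_fin; apply: ler_wpM2l; first by rewrite mulr_ge0 ?pi_ge0.
  rewrite ler_wpM2r ?invr_ge0 ?(ltW e0)//.
  apply: (le_trans (meanK n p)).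
  apply: ler_wpM2l; first exact: K_ge0.
  by rewrite lerXn2r ?nnegrE// ?subr_ge0 ?v_nd ?leq_addr// (le_trans _ (Hd 0%N))// addn0 subrr.
pose Z e := \bigcap_p U e p.
have mZ e : measurable (Z e) by apply: bigcap_measurable => //; exists 0%N.
have muZ e : 0 < e -> mu (Z e) = 0%E.
  move=> e0; apply/eqP; rewrite -measure_le0; apply/lee_addgt0Pr => t t0.
  rewrite add0e; have K0 : 0 < 2 * pi * (K / e) + 1.
    apply: ltr_wpDl => //; apply: mulr_ge0; first by rewrite mulr_ge0 ?pi_ge0.
    by rewrite divr_ge0// ltW.
  (* The cap 1 gives d^2 <= d, so that a bound linear in [d] suffices. *)
  pose d := Num.min 1 (t / (2 * pi * (K / e) + 1)).
  have d0 : 0 < d by rewrite lt_min ltr01 divr_gt0.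
  have [p Hp] := mass_tail d0.
  apply: (@le_trans _ _ (mu (U e p))).
    by apply: le_measure; rewrite ?inE; [exact: mZ|exact: mU|exact: bigcap_inf].
  apply: le_trans (muU _ _ _ e0 Hp) _; rewrite lee_fin.
  apply: (@le_trans _ _ ((2 * pi * (K / e) + 1) * d)).
    have -> : 2 * pi * (K * d ^+ 2 / e) = 2 * pi * (K / e) * d ^+ 2.
      by field; rewrite gt_eqF.
    apply: (@le_trans _ _ ((2 * pi * (K / e) + 1) * d ^+ 2)).
      by rewrite ler_wpM2r ?sqr_ge0// lerDl.
    rewrite ler_wpM2l ?(ltW K0)// expr2 ler_piMl ?(ltW d0)//.
    by rewrite /d ge_min lexx.
  by rewrite mulrC -ler_pdivlMr// /d ge_min lexx orbT.
suff sub : (~` [set x | ccvg (fun k => S k x)]) `&` I `<=` \bigcup_n Z (n.+1%:R^-1).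
  apply: (@negligibleS _ _ _ mu _ _ sub).
  by apply: negligible_bigcup => n; exists (Z n.+1%:R^-1); split; [exact: mZ| |by []];
  apply: muZ; rewrite invr_gt0.
move=> x [/= nc Ix]; apply: contrapT => H; apply: nc; apply: cauchy_ccvg => e e0.
apply: contrapT => nN; apply: H.
have e20 : 0 <= (e ^+ 2)^-1 by rewrite invr_ge0 sqr_ge0.
(* Failure of the Cauchy property at level [e] for [nq] gives level e^2 for [maxdiff], which is
   built from squares of [nq]. *)
exists (Num.bound (e ^+ 2)^-1) => // p _.
have [n Hn] : exists n, e < nq (S (p + n) x - S p x).
  apply: contrapT => H; apply: nN; exists p => n pn; rewrite leNgt; apply/negP => ne.
  by apply: H; exists (n - p)%N; rewrite subnKC.
exists n => //; split => //=.
apply: le_trans (le_maxdiff S p x (leqnn n)).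
apply: (@le_trans _ _ (e ^+ 2)); last first.
  by rewrite lerXn2r ?nnegrE ?nq_ge0 ?(ltW e0)// ltW.
rewrite -[leRHS]invrK lef_pV2 ?posrE ?invr_gt0 ?exprn_gt0 ?ltr0n//.
by rewrite (le_trans (ltW (archi_boundP e20)))// ler_nat.
Unshelve. all: by end_near.
Qed.

End almost_everywhere.

(** * Lambda(4) sets *)

Section lambda4.
Variable R : realType.
Implicit Types (A B : set int) (C : R) (c : int -> R[i]) (E : {fset int}).

Definition mass c E : R := \sum_(m <- E) nq (c m).

Lemma mass_ge0 c E : 0 <= mass c E.
Proof. by apply: sumr_ge0 => m _; exact: nq_ge0. Qed.

(* The Lambda(4) property of Rudin. *)
Definition L4 A C := forall a c E, (forall m, m \in E -> A m) ->
  mean a (fun x => nq (trig_sum c E x) ^+ 2) <= C * mass c E ^+ 2.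

Lemma cont_trig_sum c E : continuous (fun x : R => nq (trig_sum c E x)).
Proof. exact: (tpoly_contnq (@tpoly_trig_sum _ setT c E (fun _ _ => I))). Qed.

Lemma L4S A B C : A `<=` B -> L4 B C -> L4 A C.
Proof. by move=> AB H a c E EA; apply: H => m /EA /AB. Qed.

Lemma L4_set1 m : L4 [set m] 1.
Proof.
move=> a c E Em.
have [mE|mE] := boolP (m \in E); last first.
  have -> : E = fset0.
    by apply/fsetP => k; rewrite inE; apply/negP => kE; rewrite -(Em _ kE) kE in mE.
  rewrite mul1r; under eq_mean do rewrite /trig_sum big_seq_fset0 nq0 expr0n.
  by rewrite mean_cst sqr_ge0.
have -> : E = [fset m]%fset.
  by apply/fsetP => k; rewrite inE; apply/idP/eqP => [/Em|->].
under eq_mean do rewrite /trig_sum big_seq_fset1 nqM nq_expi mulr1.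
by rewrite mean_cst mul1r /mass big_seq_fset1.
Qed.

Lemma trig_sumID c E (P : pred int) x : trig_sum c E x =
  trig_sum c [fset m in E | P m]%fset x + trig_sum c [fset m in E | ~~ P m]%fset x :> R[i].
Proof. by rewrite /trig_sum (big_fsetID _ P). Qed.

Lemma massID c E (P : pred int) : mass c E =
  mass c [fset m in E | P m]%fset + mass c [fset m in E | ~~ P m]%fset.
Proof. by rewrite /mass (big_fsetID _ P). Qed.

Lemma L4U A B C C' : 0 <= C -> 0 <= C' -> L4 A C -> L4 B C' ->
  L4 (A `|` B) (8 * (C + C')).
Proof.
move=> C0 C'0 HA HB a c E EAB.
pose E1 := [fset m in E | `[< A m >]]%fset; pose E2 := [fset m in E | ~~ `[< A m >]]%fset.
have H1 : mean a (fun x => nq (trig_sum c E1 x) ^+ 2) <= C * mass c E1 ^+ 2.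
  by apply: HA => m; rewrite !inE => /andP[_ /asboolP].
have H2 : mean a (fun x => nq (trig_sum c E2 x) ^+ 2) <= C' * mass c E2 ^+ 2.
  by apply: HB => m; rewrite !inE => /andP[/EAB[Am /asboolP//|]].
have c1 : continuous (fun x : R => nq (trig_sum c E1 x) ^+ 2).
  by apply: contX; exact: cont_trig_sum.
have c2 : continuous (fun x : R => nq (trig_sum c E2 x) ^+ 2).
  by apply: contX; exact: cont_trig_sum.
apply: (@le_trans _ _ (mean a (fun x => 8 * nq (trig_sum c E1 x) ^+ 2 +
   8 * nq (trig_sum c E2 x) ^+ 2))).
  apply: le_mean; first by apply: contX; exact: cont_trig_sum.
    by apply: contD; exact: contZ.
  move=> x; rewrite (trig_sumID c E (fun m => `[< A m >])).
  have := nq2D_le (trig_sum c E1 x) (trig_sum c E2 x) (ltr01 : 0 < (1 : R)).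
  rewrite invr1; have -> : (1 + 1) ^+ 3 = 8 :> R by ring.
  by [].
rewrite meanD; [|exact: contZ|exact: contZ].
rewrite !meanZ// (massID c E (fun m => `[< A m >])) -/E1 -/E2.
have m1 := mass_ge0 c E1; have m2 := mass_ge0 c E2.
move: H1 H2; set u := mass c E1 in m1 *; set w := mass c E2 in m2 *.
move=> H1 H2.
have h1 : C * u ^+ 2 <= C * (u + w) ^+ 2.
  by apply: ler_wpM2l => //; rewrite lerXn2r ?nnegrE ?addr_ge0// lerDl.
have h2 : C' * w ^+ 2 <= C' * (u + w) ^+ 2.
  by apply: ler_wpM2l => //; rewrite lerXn2r ?nnegrE ?addr_ge0// lerDr.
have -> : 8 * (C + C') * (u + w) ^+ 2 = 8 * (C * (u + w) ^+ 2 + C' * (u + w) ^+ 2) by ring.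
rewrite -mulrDr; apply: ler_wpM2l; first exact: ler0n.
by apply: lerD; [exact: le_trans H1 h1|exact: le_trans H2 h2].
Qed.

(** Translating the frequencies by [t] multiplies the sum by a function of modulus 1. *)
Lemma L4_shift A C t : L4 A C -> L4 [set m | A (m - t)] C.
Proof.
move=> HA a c E EA.
pose E' := [fset (m - t)%R | m in E]%fset.
have inj : {in E &, injective (fun m : int => m - t)} by move=> m k _ _ /addIr.
have -> : mass c E = mass (fun m => c (m + t)) E'.
  rewrite /mass big_imfset//=; apply: eq_bigr => m _; by rewrite subrK.
have E'A m : m \in E' -> A m by move=> /imfsetP[k /= kE ->]; exact: EA.
apply: le_trans (HA a (fun m => c (m + t)) E' E'A).
apply: le_mean; [by apply: contX; exact: cont_trig_sum..|].
move=> x; have -> : trig_sum c E x = expi (t%:~R * x) * trig_sum (fun m => c (m + t)) E' x.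
  rewrite /trig_sum big_imfset//= mulr_sumr; apply: eq_bigr => m _.
  by rewrite mulrCA -expiMD subrK addrC subrK.
by rewrite nqM nq_expi mul1r.
Qed.

(** The optimization that ends a Cauchy-Schwarz argument: the minimum is at r = t/(4s). If [s] or
    [t] is 0 there is no minimizer, and [r] is sent to infinity or to 0 instead. *)
Lemma amgm_le (z C s t : R) : 0 <= C -> 0 <= s -> 0 <= t ->
  (forall r, 0 < r -> z <= C * (16 * r * s ^+ 2 + t ^+ 2 / r)) -> z <= 8 * (C * s * t).
Proof.
move=> C0 s0 t0 H.
have [sE|sn0] := eqVneq s 0.
  rewrite sE mulr0 mul0r mulr0; apply/ler_addgt0Pr => e e0; rewrite add0r.
  have r0 : 0 < C * t ^+ 2 / e + 1.
    by apply: ltr_wpDl => //; rewrite divr_ge0 ?(ltW e0)// mulr_ge0 ?sqr_ge0.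
  apply: le_trans (H _ r0) _; rewrite sE expr0n /= mulr0 add0r mulrA ler_pdivrMr//.
  by rewrite mulrDr mulr1 [e * _]mulrC divfK ?gt_eqF// lerDl ltW.
have [tE|tn0] := eqVneq t 0.
  rewrite tE mulr0 mulr0; apply/ler_addgt0Pr => e e0; rewrite add0r.
  have d0 : 0 < C * (16 * s ^+ 2) + 1.
    by apply: ltr_wpDl => //; rewrite !mulr_ge0 ?sqr_ge0 ?ler0n.
  have r0 : 0 < e / (C * (16 * s ^+ 2) + 1) by rewrite divr_gt0.
  apply: le_trans (H _ r0) _; rewrite tE expr0n /= mul0r addr0.
  set d := _ + 1 in d0 *.
  have -> : C * (16 * (e / d) * s ^+ 2) = (C * (16 * s ^+ 2)) * e / d by ring.
  by rewrite ler_pdivrMr// mulrC ler_wpM2l ?(ltW e0)// /d lerDl.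
have s1 : 0 < s by rewrite lt_neqAle eq_sym sn0.
have t1 : 0 < t by rewrite lt_neqAle eq_sym tn0.
have r0 : 0 < t / (4 * s) by rewrite divr_gt0 ?mulr_gt0 ?ltr0n.
apply: le_trans (H _ r0) _.
have -> : C * (16 * (t / (4 * s)) * s ^+ 2 + t ^+ 2 / (t / (4 * s))) = 8 * (C * s * t).
  by field; rewrite sn0 tn0.
exact: lexx.
Qed.

(** With f, p the squared moduli and r the real part of the product of [w] and the conjugate of [z],
    the left side is (f + p + 2r)^2. The term 4fr is kept exactly, since it will have mean 0; the
    others are bounded by r^2 <= f p and 2r <= f + p. *)
Lemma nqD_sqr_le (z w : R[i]) : nq (z + w) ^+ 2 <=
  nq z ^+ 2 + 4 * complex.Re (z * z^* * (z^* * w)) + 8 * (nq z * nq w) + 3 * nq w ^+ 2.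
Proof.
case: z w => [a b] [c d]; rewrite /nq /=.
set f := a ^+ 2 + b ^+ 2; set p := c ^+ 2 + d ^+ 2; pose r := a * c + b * d.
have -> : (a + c) ^+ 2 + (b + d) ^+ 2 = f + p + 2 * r by rewrite /f /p /r; ring.
have -> : (a * a - b * - b) * (a * c - - b * d) - (a * - b + b * a) * (a * d + - b * c) = f * r.
  by rewrite /f /r; ring.
have rfp : r ^+ 2 <= f * p.
  rewrite -subr_ge0; have -> : f * p - r ^+ 2 = (a * d - b * c) ^+ 2.
    by rewrite /f /p /r; ring.
  exact: sqr_ge0.
have p0 : 0 <= p by rewrite addr_ge0 ?sqr_ge0.
have : 2 * r <= f + p.
  rewrite -subr_ge0; have -> : f + p - 2 * r = (a - c) ^+ 2 + (b - d) ^+ 2.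
    by rewrite /f /p /r; ring.
  by rewrite addr_ge0 ?sqr_ge0.
move=> /(ler_wpM2l p0); move: rfp; clearbody f p r; clear; lra.
Qed.

(** Induction on a bound for [top], splitting off the largest value. If u, w are the masses of the
    two parts and K the constant sought, Cauchy-Schwarz gives K u^2 + 8 sqrt(K C) u w + 3 C w^2.
    This is at most K (u + w)^2 once 8 sqrt(K C) <= 2 K, whence K = 16 C. *)
Lemma L4_lacunary A C (top : int -> nat) : 0 <= C ->
  (forall m m1 m2 m3, A m -> A m1 -> A m2 -> A m3 ->
     (top m1 < top m)%N -> (top m2 < top m)%N -> (top m3 < top m)%N ->
     m + m1 - m2 - m3 != 0) ->
  (forall k, L4 [set m | A m /\ top m = k] C) -> L4 A (16 * C).
Proof.
move=> C0 sep blockL4 a c E EA.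
have [K] : exists K, forall m, m \in E -> (top m < K)%N.
  by exists (\max_(m <- E) top m).+1 => m mE; rewrite ltnS leq_bigmax_seq.
elim: K E EA => [|K IH] E EA topE.
  have -> : E = fset0 by apply/fsetP => m; rewrite inE; apply/negP => /topE.
  rewrite /mass big_seq_fset0 expr0n mulr0.
  by under eq_mean do rewrite /trig_sum big_seq_fset0 nq0 expr0n; rewrite mean_cst.
pose E1 := [fset m in E | (top m < K)%N]%fset.
pose E2 := [fset m in E | ~~ (top m < K)%N]%fset.
have E1A m : m \in E1 -> A m by rewrite !inE => /andP[/EA].
have E1K m : m \in E1 -> (top m < K)%N by rewrite !inE => /andP[].
have E2A m : m \in E2 -> A m /\ top m = K.
  rewrite !inE -leqNgt => /andP[mE Km]; split; first exact: EA.
  by apply/eqP; rewrite eqn_leq Km -ltnS topE.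
pose f x := nq (trig_sum c E1 x : R[i]); pose p x := nq (trig_sum c E2 x : R[i]).
have cf : continuous f by exact: cont_trig_sum.
have cp : continuous p by exact: cont_trig_sum.
have IH1 : mean a (fun x => f x ^+ 2) <= 16 * C * mass c E1 ^+ 2 by exact: IH.
have IH2 : mean a (fun x => p x ^+ 2) <= C * mass c E2 ^+ 2 by exact: (blockL4 K).
pose F x : R[i] := trig_sum c E1 x; pose P x : R[i] := trig_sum c E2 x.
have [B tB B0] : exists2 B : set int,
    tpoly B (fun x => F x * (F x)^* * ((F x)^* * P x)) & ~ B 0.
  have tF : tpoly [set m | m \in E1] F by exact: tpoly_trig_sum.
  have tP : tpoly [set m | m \in E2] P by exact: tpoly_trig_sum.
  eexists; first exact: (tpolyM (tpolyM tF (tpoly_conj tF)) (tpolyM (tpoly_conj tF) tP)).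
  move=> [_ [_ [[m1 [m2 [/= m1E m2E ->]]] [m3 [m [/= m3E mE ->]]]]]] /esym/eqP.
  have [Am mK] := E2A _ mE; rewrite -[m2]opprK -[m3]opprK.
  have -> : m1 - - m2 + (- - m3 + m) = m + m1 - (- m2) - (- m3) by ring.
  apply/negP; apply: sep => //; try exact: E1A; rewrite mK; exact: E1K.
have mean_lin : mean a (fun x => complex.Re (F x * (F x)^* * ((F x)^* * P x))) = 0.
  exact: mean_tpoly tB B0.
have cre := tpoly_contRe tB.
have cfp : continuous (fun x => f x * p x) by exact: contM.
have cf2 : continuous (fun x => f x ^+ 2) by exact: contX.
have cp2 : continuous (fun x => p x ^+ 2) by exact: contX.
have Hfp : 2 * mean a (fun x => f x * p x) <= 8 * (C * mass c E1 * mass c E2).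
  apply: amgm_le; rewrite ?mass_ge0// => r r0.
  rewrite -meanZ//; apply: (@le_trans _ _ (mean a (fun x => r * f x ^+ 2 + r^-1 * p x ^+ 2))).
    apply: le_mean; [exact: contZ|by apply: contD; exact: contZ|] => x.
    rewrite -subr_ge0.
    have -> : r * f x ^+ 2 + r^-1 * p x ^+ 2 - 2 * (f x * p x) = r^-1 * (r * f x - p x) ^+ 2.
      by field; rewrite gt_eqF.
    by rewrite mulr_ge0 ?sqr_ge0// invr_ge0 ltW.
  rewrite meanD; [|exact: contZ|exact: contZ]; rewrite !meanZ//.
  have -> : C * (16 * r * mass c E1 ^+ 2 + mass c E2 ^+ 2 / r) =
     r * (16 * C * mass c E1 ^+ 2) + r^-1 * (C * mass c E2 ^+ 2) by ring.
  by apply: lerD; apply: ler_wpM2l => //; rewrite ?invr_ge0 ltW.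
rewrite (massID c E (fun m => top m < K)%N) -/E1 -/E2.
apply: (@le_trans _ _ (mean a (fun x => f x ^+ 2 +
    (4 * complex.Re (F x * (F x)^* * ((F x)^* * P x)) +
    (8 * (f x * p x) + 3 * p x ^+ 2))))).
  apply: le_mean; first by apply: contX; exact: cont_trig_sum.
    by apply: contD => //; apply: contD; [|apply: contD]; exact: contZ.
  move=> x; rewrite (trig_sumID c E (fun m => top m < K)%N) !addrA.
  exact: nqD_sqr_le.
rewrite meanD//; last by apply: contD; [|apply: contD]; exact: contZ.
rewrite meanD; [|exact: contZ|by apply: contD; exact: contZ].
rewrite meanD; [|exact: contZ|exact: contZ].
rewrite !meanZ// mean_lin mulr0 add0r.
move: (mass_ge0 c E1) (mass_ge0 c E2) IH1 IH2 Hfp.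
set u := mass c E1; set w := mass c E2.
set M1 := mean _ _; set M2 := mean _ _; set M3 := mean _ _.
move=> u0 w0 H1 H2 H3.
have Cw : 0 <= C * w ^+ 2 by rewrite mulr_ge0 ?sqr_ge0.
by move: H1 H2 H3 Cw; clear; lra.
Qed.

End lambda4.

(** * Signed sums of a lacunary sequence *)

Section lacunary_sums.
Variables (R : realType) (n : nat -> nat).

(** The sums of [signed_sums], built from the largest index down with [K] as a strict bound on the
    indices; the induction on [l] in [L4_free_sums] follows this recursion. *)
Fixpoint bounded_sums (l K : nat) (m : int) : Prop :=
  if l is l'.+1 then exists k (s m' : int),
    [/\ (k < K)%N, s = 1 \/ s = -1, bounded_sums l' k m' & m = s * (n k)%:Z + m']
  else m = 0.

Definition free_sums (l : nat) : set int := [set m | exists K, bounded_sums l K m].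

Lemma signed_sums_free l : signed_sums n l `<=` free_sums l.
Proof.
move=> m [eps [k [eps1 kdec ->]]].
suff H K : (forall j, (k j < K)%N) ->
    bounded_sums l K (\sum_(j < l) eps j * (n (k j))%:Z).
  by exists (\max_j k j).+1; apply: H => j; rewrite ltnS leq_bigmax.
elim: l eps k eps1 kdec K => [|l IH] eps k eps1 kdec K kK; first by rewrite big_ord0.
rewrite big_ord_recl; exists (k ord0), (eps ord0).
exists (\sum_(j < l) eps (lift ord0 j) * (n (k (lift ord0 j)))%:Z); split => //.
apply: (IH (fun j => eps (lift ord0 j)) (fun j => k (lift ord0 j))) => [j|i j ij|j].
- exact: eps1.
- by apply: kdec.
- by apply: kdec.
Qed.

Variable lam : R.
Hypotheses (lam1 : 1 < lam) (lac : lacunary lam n).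

Let lam0 : 0 < lam. Proof. exact: lt_trans ltr01 lam1. Qed.

Lemma lacunaryS k : lam * (n k)%:R <= (n k.+1)%:R.
Proof.
have [n0 nl] := lac; have := nl k.
by rewrite ltr_pdivlMr ?ltr0n// => /ltW.
Qed.

Lemma lacunaryD k j : lam ^+ j * (n k)%:R <= (n (k + j))%:R.
Proof.
elim: j => [|j IH]; first by rewrite expr0 mul1r addn0.
rewrite addnS exprS -mulrA; apply: le_trans (lacunaryS _).
by rewrite ler_wpM2l// ltW.
Qed.

Lemma lacunary_lt k K : (k < K)%N -> lam * (n k)%:R <= (n K)%:R.
Proof.
move=> kK; rewrite -(subnKC kK) addSnnS; apply: le_trans (lacunaryD _ _).
apply: ler_wpM2r; first exact: ler0n.
by rewrite exprS -[leLHS]mulr1; apply: ler_wpM2l; [exact: ltW|rewrite exprn_ege1// ltW].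
Qed.

(** Bounds the ratio of a signed sum of [l] terms to any later term of the sequence. At length
    [l.-1] it equals 1 exactly for the critical ratio of [l], see [geom_critical] and [geom_lt1]. *)
Definition geom (l : nat) : R := \sum_(i < l) lam^-1 ^+ i.+1.

Lemma geomS l : geom l.+1 = lam^-1 * (1 + geom l).
Proof.
rewrite /geom big_ord_recl mulrDr mulr1 expr1 mulr_sumr.
by congr (_ + _); apply: eq_bigr => i _; rewrite -exprS.
Qed.

Lemma geom_ge0 l : 0 <= geom l.
Proof. by apply: sumr_ge0 => i _; rewrite exprn_ge0// invr_ge0 ltW. Qed.

Lemma geom_nd l l' : (l <= l')%N -> geom l <= geom l'.
Proof.
move=> /subnKC <-; elim: (l' - l)%N => [|j IH]; first by rewrite addn0.
apply: (le_trans IH); rewrite addnS /geom big_ord_recr lerDl /=.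
by rewrite exprn_ge0// invr_ge0 ltW.
Qed.

Lemma bounded_sums_le l K m : bounded_sums l K m ->
  `|m%:~R| <= geom l * (n K)%:R :> R.
Proof.
elim: l K m => [|l IH] K m /=.
  by move=> ->; rewrite normr0 mulr_ge0 ?geom_ge0.
move=> [k [s [m' [kK s1 /IH m'k ->]]]].
rewrite intrD intrM; apply: le_trans (ler_normD _ _) _.
have -> : `|s%:~R * (n k)%:~R| = (n k)%:R :> R.
  by case: s1 => ->; rewrite ?mul1r ?rmorphN1 ?mulN1r ?normrN ger0_norm ?ler0z.
have : lam^-1 * (lam * (n k)%:R) <= lam^-1 * (n K)%:R.
  by apply: ler_wpM2l; [rewrite invr_ge0 ltW|exact: lacunary_lt].
rewrite mulrA mulVf ?mul1r ?gt_eqF// => nk.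
rewrite geomS -mulrA mulrC -mulrA [_%:R / _]mulrC.
have := geom_ge0 l; set g := geom l in m'k * => g0.
apply: (@le_trans _ _ ((1 + g) * (n k)%:R)); first by rewrite mulrDl mul1r lerD2l.
by apply: ler_wpM2l => //; rewrite addr_ge0.
Qed.

Variable L : nat.
Hypothesis geomL : geom L.-1 < 1.

(** The other terms amount to at most [geom L.-1] < 1 times the top one, so they cannot cancel it.
    [L] is the final length, and [l] runs below it in the induction. *)
Lemma top_size l k (s m' : int) : (l < L)%N -> s = 1 \/ s = -1 ->
  bounded_sums l k m' ->
  (1 - geom L.-1) * (n k)%:R <= `|(s * (n k)%:Z + m')%:~R| :> R /\
  `|(s * (n k)%:Z + m')%:~R| <= 2 * (n k)%:R :> R.
Proof.
move=> lL s1 /bounded_sums_le m'k.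
have nk : `|s%:~R * (n k)%:~R| = (n k)%:R :> R.
  by case: s1 => ->; rewrite ?mul1r ?rmorphN1 ?mulN1r ?normrN ger0_norm ?ler0z.
have gl : geom l <= geom L.-1 by apply: geom_nd; lia.
have m'g : `|m'%:~R| <= geom L.-1 * (n k)%:R :> R.
  by apply: le_trans m'k _; apply: ler_wpM2r.
rewrite intrD intrM; split.
  apply: le_trans (lerB_normD _ _); rewrite nk mulrBl mul1r; lra.
apply: le_trans (ler_normD _ _) _; rewrite nk.
have : geom L.-1 * (n k)%:R <= 1 * (n k)%:R.
  by apply: ler_wpM2r => //; exact: ltW.
lra.
Qed.

Lemma L4_free_sums l : (l <= L)%N -> exists2 C : R, 0 <= C & L4 (free_sums l) C.
Proof.
elim: l => [_|l IH lL].
  by exists 1 => //; apply: L4S (@L4_set1 R 0) => m [K /= ->].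
have [C C0 HC] := IH (ltnW lL).
(* 6 is 2 times 3: an element is at most 2 times its top term, and three elements of lower top index
   must stay below [|m|] together, so each below a third of it. Powers of [lam] are unbounded by
   Bernoulli's inequality. *)
have [q q0 qlam] : exists2 q, (0 < q)%N & 6 < (1 - geom L.-1) * lam ^+ q.
  have g1 : 0 < 1 - geom L.-1 by rewrite subr_gt0.
  have h : 0 <= 6 / (1 - geom L.-1) / (lam - 1).
    by rewrite !divr_ge0 ?ler0n ?subr_ge0 ?ltW// -subr_gt0.
  exists (Num.bound (6 / (1 - geom L.-1) / (lam - 1))).+1 => //.
  rewrite mulrC -ltr_pdivrMr//; move: (archi_boundP h); set b := Num.bound _.
  have l1 : 0 < lam - 1 by rewrite subr_gt0.
  rewrite (ltr_pdivrMr _ _ l1) => /lt_le_trans; apply.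
  apply: (@le_trans _ _ (lam ^+ b)); last first.
    by rewrite exprS ler_peMl ?exprn_ge0// ltW.
  elim: (b) => [|j IHj]; first by rewrite mul0r ler01.
  rewrite exprS -natr1 mulrDl mul1r.
  have : (lam - 1) * 1 <= (lam - 1) * lam ^+ j.
    by rewrite ler_wpM2l ?(ltW l1)// exprn_ege1// ltW.
  lra.
(* An integer may have several representations; one top index is selected once and for all. *)
have [top topP] : exists top : int -> nat, forall m, free_sums l.+1 m ->
    exists (s m' : int), [/\ s = 1 \/ s = -1, bounded_sums l (top m) m' &
      m = s * (n (top m))%:Z + m'].
  suff : forall m, exists k, free_sums l.+1 m -> exists (s m' : int),
    [/\ s = 1 \/ s = -1, bounded_sums l k m' & m = s * (n k)%:Z + m'].
    by move=> /choice[top topP]; exists top.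
  move=> m; have [[K [k [s [m' [_ s1 b e]]]]]|nf] := pselect (free_sums l.+1 m).
    by exists k => _; exists s, m'.
  by exists 0%N.
(* Within one residue class, distinct top indices differ by at least [q]. *)
pose A r := [set m | free_sums l.+1 m /\ (top m %% q)%N = r].
pose C' := 16 * (8 * (C + C)).
have C'0 : 0 <= C' by rewrite /C' !mulr_ge0 ?addr_ge0 ?ler0n.
have HA r : L4 (A r) C'.
  apply: (@L4_lacunary _ _ _ top); first by rewrite !mulr_ge0 ?addr_ge0 ?ler0n.
    move=> m m1 m2 m3 [mF mr] Am1 Am2 Am3 t1 t2 t3.
    have [s [m' [s1 bm' me]]] := topP _ mF.
    have [lo _] := top_size lL s1 bm'; rewrite -me in lo.
    have small m0 : A r m0 -> (top m0 < top m)%N ->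
        6 * `|m0%:~R| < 2 * `|m%:~R| :> R.
      move=> [m0F m0r] t0.
      have [s' [m0' [s1' bm0' m0e]]] := topP _ m0F.
      have [_ hi] := top_size lL s1' bm0'; rewrite -m0e in hi.
      have tq : (top m0 + q <= top m)%N.
        have := divn_eq (top m0) q; have := divn_eq (top m) q; rewrite mr m0r.
        move: t0 q0; set d := (top m %/ q)%N; set d' := (top m0 %/ q)%N.
        by move=> t0 q0 e1 e2; move: t0; rewrite e1 e2 ltn_add2r ltn_mul2r q0 /=; nia.
      have := lacunaryD (top m0) (top m - top m0).
      rewrite subnKC ?(ltnW t0)// => nlam.
      have lq : lam ^+ q <= lam ^+ (top m - top m0).
        by rewrite ler_eXn2l// leq_subRL // (ltnW t0).
      have n0 : 0 < (n (top m0))%:R :> R by rewrite ltr0n; case: lac.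
      have g1 : 0 < 1 - geom L.-1 by rewrite subr_gt0.
      have : 6 * (n (top m0))%:R < (1 - geom L.-1) * (n (top m))%:R.
        apply: lt_le_trans (ler_wpM2l (ltW g1) nlam).
        rewrite mulrA ltr_pM2r//; apply: lt_le_trans qlam _.
        by rewrite ler_pM2l.
      by move: lo hi; lra.
    apply/eqP => H0.
    have e : m%:~R = - m1%:~R + (m2%:~R + m3%:~R) :> R.
      by rewrite -intrN -!intrD; congr (_%:~R); lia.
    have : `|m%:~R| <= `|m1%:~R| + (`|m2%:~R| + `|m3%:~R|) :> R.
      rewrite e; apply: le_trans (ler_normD _ _) _; rewrite normrN lerD2l.
      exact: ler_normD.
    have := small _ Am1 t1; have := small _ Am2 t2; have := small _ Am3 t3.
    set x1 := `|_|; set x := `|_|; set x2 := `|_|; set x3 := `|_|; lra.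
  move=> k; have sub : [set m | A r m /\ top m = k] `<=`
      [set m | free_sums l (m - (n k)%:Z)] `|` [set m | free_sums l (m - (- (n k)%:Z))].
    move=> m [[mF _] <-]; have [s [m' [s1 bm' me]]] := topP _ mF.
    case: s1 => s1; [left|right]; exists (top m).
      have -> : m - (n (top m))%:Z = m' by rewrite {1}me s1 mul1r addrAC subrr add0r.
      exact: bm'.
    have -> : m - - (n (top m))%:Z = m'.
      by rewrite {1}me s1 mulN1r opprK addrAC addNr add0r.
    exact: bm'.
  by apply: L4S sub _; apply: L4U => //; exact: L4_shift.
have [C2 C20 HC2] : exists2 C2 : R, 0 <= C2 &
    L4 [set m | free_sums l.+1 m /\ (top m %% q < q)%N] C2.
  (* The classes are added one at a time, keeping the modulus fixed; with no class the set is empty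
     and any constant does. *)
  elim: {2}q => [|j [C2 C20 HC2]].
    by exists C' => //; apply: L4S (HA 0%N) => m [].
  exists (8 * (C2 + C')); first by rewrite mulr_ge0 ?addr_ge0 ?ler0n.
  apply: L4S (L4U C20 C'0 HC2 (HA j)) => m [mF].
  by rewrite ltnS leq_eqVlt => /orP[/eqP h|h]; [right|left].
exists C2 => //; apply: L4S HC2 => m mF; split => //; exact: ltn_pmod.
Qed.

End lacunary_sums.

(** * Almost everywhere convergence above the critical ratio *)

Section convergence.
Variable R : realType.
Local Notation crit := (critical_ratio R).

Lemma critical_ratio_eq l : (2 <= l)%N -> crit l ^+ l.-1 = \sum_(i < l.-1) crit l ^+ i.
Proof.
rewrite leq_eqVlt => /orP[/eqP <-|l3]; first by rewrite /critical_ratio /= big_ord1 expr1 expr0.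
by have [] := critical_ratioP R l3.
Qed.

Lemma critical_ratio_ge1 l : (2 <= l)%N -> 1 <= crit l.
Proof.
rewrite leq_eqVlt => /orP[/eqP <-|l3]; first by rewrite /critical_ratio.
by have [/ltW] := critical_ratioP R l3.
Qed.

(** The defining equation divided by x^(l-1), with the sum reversed; for l = 2 it reads 1 = 1. *)
Lemma geom_critical l : (2 <= l)%N -> geom (crit l) l.-1 = 1.
Proof.
move=> l2; have c1 := critical_ratio_ge1 l2.
have c0 : crit l != 0 by rewrite gt_eqF// (lt_le_trans ltr01).
rewrite /geom (reindex_inj rev_ord_inj) /=.
apply: (@mulfI _ (crit l ^+ l.-1)); first by rewrite expf_neq0.
rewrite mulr1 [in RHS]critical_ratio_eq// mulr_sumr; apply: eq_bigr => -[i il] _ /=.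
rewrite -{1}(subnK il) exprD exprVn -mulrA.
have -> : (l.-1 - i.+1).+1 = (l.-1 - i)%N by lia.
rewrite [in LHS]mulrA -exprD; have -> : (l.-1 - i.+1 + i.+1 = l.-1 - i + i)%N by lia.
by rewrite exprD mulrAC divff ?mul1r// expf_neq0.
Qed.

Lemma geom_lt1 l lam : (2 <= l)%N -> crit l < lam -> geom lam l.-1 < 1.
Proof.
move=> l2 cl; have c1 := critical_ratio_ge1 l2.
have c0 : 0 < crit l by rewrite (lt_le_trans ltr01).
have l0 : 0 < lam by exact: lt_trans cl.
rewrite -(geom_critical l2); apply: ltr_sum => [|i _].
  have l1 : (0 < l.-1)%N by lia.
  by apply/hasP; exists (Ordinal l1); rewrite ?mem_index_enum.
by rewrite ltr_pXn2r// ?nnegrE ?invr_ge0 ?(ltW c0) ?(ltW l0)// ltf_pV2.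
Qed.

Lemma mass_fsetD (c : int -> R[i]) (E F : {fset int}) : (E `<=` F)%fset ->
  mass c (F `\` E)%fset = mass c F - mass c E.
Proof.
move=> EF; rewrite /mass [in RHS](big_fsetID _ (fun m => m \in E) F).
have -> : [fset x in F | x \in E]%fset = E.
  apply/fsetP => m; rewrite !inE /=; apply/andP/idP => [[]//|mE].
  by split => //; exact: (fsubsetP EF).
suff -> : (F `\` E = [fset m in F | ~~ (m \in E)])%fset by rewrite addrC addKr.
by apply/fsetP => m; rewrite !inE andbC.
Qed.

Lemma trig_sum_fsetD (c : int -> R[i]) (E F : {fset int}) (x : R) : (E `<=` F)%fset ->
  trig_sum c (F `\` E)%fset x = trig_sum c F x - trig_sum c E x.
Proof.
move=> EF; rewrite /trig_sum [in RHS](big_fsetID _ (fun m => m \in E) F).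
have -> : [fset x in F | x \in E]%fset = E.
  apply/fsetP => m; rewrite !inE /=; apply/andP/idP => [[]//|mE].
  by split => //; exact: (fsubsetP EF).
suff -> : (F `\` E = [fset m in F | ~~ (m \in E)])%fset by rewrite addrC addKr.
by apply/fsetP => m; rewrite !inE andbC.
Qed.

Lemma square_summable_mass (A : set int) (c : int -> R[i]) : square_summable A c ->
  exists B : R, forall E : {fset int}, (forall m, m \in E -> A m) -> mass c E <= B.
Proof.
rewrite /square_summable; set s := esum _ _ => sfin.
exists (fine s) => E EA.
have s0 : (0 <= s)%E by apply: esum_ge0 => m _; rewrite lee_fin sqr_ge0.
rewrite -lee_fin fineK ?ge0_fin_numE//; apply: esum_ge.
exists [set` E]; first by split => //; move=> m /=; exact: EA.
rewrite fsbig_finite//= set_fsetK sumEFin lee_fin le_eqVlt; apply/orP; left; apply/eqP.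
by apply: eq_bigr => m _; rewrite sqr_normc_nq.
Qed.

(** The difference of two partial sums is the sum over the difference of their sets, whose mass is
    the increment of [mass c (G k)]; so the property [L4] is the hypothesis of [ae_ccvg]. *)
Lemma L4_ae_ccvg (A : set int) (C : R) : 0 <= C -> L4 A C ->
  forall c : int -> R[i], square_summable A c ->
  forall G, increasing_in A G ->
  {ae @lebesgue_measure R, forall x : R, ccvg (fun k => trig_sum c (G k) x)}.
Proof.
move=> C0 HA c /square_summable_mass[B cB] G [Gnd GA].
have Gle i j : (i <= j)%N -> (G i `<=` G j)%fset.
  move=> /subnKC <-; elim: (j - i)%N => [|k IH]; first by rewrite addn0.
  by rewrite addnS (fsubset_trans IH).
apply: (@ae_ccvg _ (fun k x => trig_sum c (G k) x) (fun k => mass c (G k)) C) => //.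
- move=> i j.
  have t k : tpoly setT (trig_sum c (G k) : R -> R[i]) by apply: tpoly_trig_sum.
  have := tpoly_contnq (tpolyD (t i) (tpolyZ (-1) (t j))).
  by under eq_fun do rewrite mulN1r.
- by move=> i j ij; rewrite -subr_ge0 -mass_fsetD ?Gle// mass_ge0.
- by exists B => i; apply: cB; exact: GA.
- move=> a i j ij; rewrite -mass_fsetD ?Gle//.
  under eq_mean do rewrite -trig_sum_fsetD ?Gle//.
  by apply: HA => m; rewrite inE => /andP[_]; exact: GA.
Qed.

Lemma supercritical_ae_ccvg l lam n : (2 <= l)%N -> crit l < lam -> lacunary lam n ->
  forall c : int -> R[i], square_summable (signed_sums n l) c ->
  forall G, increasing_in (signed_sums n l) G ->
  {ae @lebesgue_measure R, forall x : R, ccvg (fun k => trig_sum c (G k) x)}.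
Proof.
move=> l2 cl lac.
have lam1 : 1 < lam by exact: le_lt_trans (critical_ratio_ge1 l2) cl.
have [C C0 HC] := L4_free_sums lam1 lac (geom_lt1 l2 cl) (leqnn l).
by apply: (L4_ae_ccvg C0); apply: L4S HC; exact: signed_sums_free.
Qed.

Lemma expi_square_integrable m :
  square_integrable (@lebesgue_measure R) `[0, 2 * pi] (fun x => expi (m%:~R * x)).
Proof.
split; rewrite /=.
- by apply: measurable_funTS; apply: measurable_realfun.continuous_measurable_fun; exact: cont_cosM.
- by apply: measurable_funTS; apply: measurable_realfun.continuous_measurable_fun; exact: cont_sinM.
- have -> : (fun x => (normc (expi (m%:~R * x)) ^+ 2)%:E) = EFin \o (fun=> 1 : R).
    by apply/funext => x; rewrite sqr_normc_nq nq_expi.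
  by apply: continuous_integrable_itv; exact: cont_cst.
Qed.

Lemma Cintegral_expi m k : m <> k ->
  Cintegral (@lebesgue_measure R) `[0, 2 * pi]
    (fun x => expi (m%:~R * x) * (expi (k%:~R * x))^*) = 0.
Proof.
move=> /eqP mk; have mk0 : m - k != 0 by rewrite subr_eq0.
have e (x : R) : expi (m%:~R * x) * (expi (k%:~R * x))^* = expi ((m - k)%:~R * x).
  by rewrite expiMD expiMN.
rewrite /Cintegral; under eq_Rintegral do rewrite e.
under [X in _ +i* X]eq_Rintegral do rewrite e.
have mean0 (f : R -> R) : mean 0 f = 0 ->
    \int[@lebesgue_measure R]_(x in `[0, 2 * pi]) f x = 0.
  rewrite /mean add0r => /eqP; rewrite mulf_eq0 invr_eq0 mulf_eq0 pnatr_eq0 /=.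
  by rewrite gt_eqF ?pi_gt0//= => /eqP.
by rewrite !mean0 //=; [exact: mean_sinM|exact: mean_cosM].
Qed.

Lemma supercritical_ucs l lam n : (2 <= l)%N -> crit l < lam -> lacunary lam n ->
  unconditional_convergence_system (@lebesgue_measure R) `[0, 2 * pi]
    (signed_sums n l) (fun (m : int) (x : R) => expi (m%:~R * x)).
Proof.
move=> l2 cl lac; split; first exact: countableP.
  by split=> [m _|m k _ _ mk]; [exact: expi_square_integrable|exact: Cintegral_expi].
move=> a aS s [sA sinj _].
(* A rearranged series is the case where the sets grow by one frequency at a time; injectivity of
   [s] keeps the sum over the set equal to the sum over indices. *)
pose G N := [fset s (nat_of_ord k) | k in 'I_N]%fset.
have GE N x : trig_sum a (G N) x = \sum_(k < N) a (s k) * expi ((s k)%:~R * x).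
  rewrite /trig_sum big_imfset//=; last first.
    by move=> i j _ _ e; apply: val_inj; apply: sinj; rewrite ?inE.
  by rewrite big_enum.
have Ginc : increasing_in (signed_sums n l) G.
  split=> [k|k m].
    apply/fsubsetP => m /imfsetP[/= j _ ->]; apply/imfsetP => /=.
    by exists (widen_ord (leqnSn k) j).
  by move=> /imfsetP[/= j _ ->]; exact: sA.
have H := supercritical_ae_ccvg l2 cl lac aS Ginc.
apply: (@negligibleS _ _ _ (@lebesgue_measure R) _ _ _ H) => x /= nc Hx; apply: nc => _.
have -> : (fun N => \sum_(k < N) a (s k) * expi ((s k)%:~R * x)) =
    (fun N => trig_sum a (G N) x) by apply/funext => N; rewrite GE.
exact: Hx.
Qed.

End convergence.

(** * Smooth approximation of the sign and independence *)

Section soft_sign.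
Variable R : realType.
Implicit Types (f g P : R -> R) (d D : nat) (q : {poly R}).

Definition tdeg d f := tpoly [set m : int | (`|m| <= d)%N] (fun x => (f x)%:C).

Lemma tdegS d D f : (d <= D)%N -> tdeg d f -> tdeg D f.
Proof. by move=> dD; apply: tpolyS => m /= md; exact: leq_trans dD. Qed.

Lemma tdeg_cst (k : R) : tdeg 0 (fun=> k).
Proof.
have : tpoly [set m : int | (`|m| <= 0)%N] (fun x : R => k%:C * expi (0%:~R * x)).
  exact: tpoly1.
by apply: eq_tpoly => x; rewrite mul0r expi0 mulr1.
Qed.

Lemma tdegD d f g : tdeg d f -> tdeg d g -> tdeg d (fun x => f x + g x).
Proof.
by move=> tf tg; apply: eq_tpoly (tpolyD tf tg) => x; rewrite rmorphD.
Qed.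

Lemma tdegM d D f g : tdeg d f -> tdeg D g -> tdeg (d + D) (fun x => f x * g x).
Proof.
move=> tf tg; apply: (@tpolyS _ _ _ _ _ (eq_tpoly _ (tpolyM tf tg))); last first.
  by move=> x; rewrite rmorphM.
by move=> m [a [b [/= ad bD ->]]]; lia.
Qed.

Lemma tdeg_cos : tdeg 1 (@cos R).
Proof.
have t : tpoly [set m : int | (`|m| <= 1)%N] (fun x : R =>
    (2^-1)%:C * expi (1%:~R * x) + (2^-1)%:C * expi ((- 1)%:~R * x)).
  by apply: tpolyD; apply: tpoly1.
apply: eq_tpoly t => x; rewrite expiMN mul1r; apply/eqP; rewrite eq_complex /=.
by apply/andP; split; apply/eqP; field.
Qed.

Lemma tdeg_poly_cos q : exists D, tdeg D (fun y => q.[cos y]).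
Proof.
elim/poly_ind: q => [|q k [D IH]].
  exists 0%N; have -> : (fun y : R => (0 : {poly R}).[cos y]) = (fun=> 0).
    by apply/funext => y; rewrite horner0.
  exact: tdeg_cst.
exists (D + 1)%N.
have -> : (fun y : R => (q * 'X + k%:P).[cos y]) = (fun y => q.[cos y] * cos y + k).
  by apply/funext => y; rewrite hornerMXaddC.
by apply: tdegD; [exact: tdegM IH tdeg_cos|apply: tdegS (tdeg_cst k)].
Qed.

Lemma tdeg_dilate D f (M : nat) : tdeg D f -> tdeg (D * M) (fun x => f (M%:R * x)).
Proof.
move=> [s sD fE]; exists [seq (p.1, p.2 * M%:Z) | p <- s].
  by move=> p /mapP[p' /sD /= pD ->] /=; rewrite abszM leq_mul2r pD orbT.
move=> x; rewrite fE big_map; apply: eq_bigr => p _ /=.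
by rewrite intrM mulrA.
Qed.

Lemma tdeg_cont d f : tdeg d f -> continuous f.
Proof. by move=> /tpoly_contRe. Qed.

(** A frequency u + v M with |u| <= d < M vanishes only if v = 0. Hence only the constant term of
    [f] contributes, as if P(x) and f(M x) were independent. *)
Lemma mean_indep a a' d D (M : nat) P f : tdeg d P -> tdeg D f -> (d < M)%N ->
  mean a (fun x => P x * f (M%:R * x)) = mean a P * mean a' f.
Proof.
move=> tP [s sD fE] dM.
have cP := tdeg_cont tP.
have tPs (p : R[i] * int) :
    tpoly [set m | exists u v, [/\ (`|u| <= d)%N, v = p.2 * M%:Z & m = u + v]]
    (fun x => (P x)%:C * (p.1 * expi ((p.2 * M%:Z)%:~R * x))).
  by apply: (tpolyM tP (@tpoly1 _ [set m | m = p.2 * M%:Z] p.1 _ erefl)).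
pose F (p : R[i] * int) (x : R) : R :=
  complex.Re ((P x)%:C * (p.1 * expi ((p.2 * M%:Z)%:~R * x))).
have -> : (fun x => P x * f (M%:R * x)) = (fun x => \sum_(p <- s) F p x).
  apply/funext => x; have -> : P x * f (M%:R * x) = complex.Re ((P x)%:C * (f (M%:R * x))%:C).
    by rewrite /= mulr0 subr0.
  rewrite fE mulr_sumr Re_sum; apply: eq_bigr => p _; by rewrite /F intrM -[_ * _ * x]mulrA.
rewrite mean_sum; last by move=> p; exact: tpoly_contRe (tPs p).
have -> : mean a' f = \sum_(p <- s) (if p.2 == 0 then complex.Re p.1 else 0).
  have -> : f = (fun x => \sum_(p <- s) complex.Re (p.1 * expi (p.2%:~R * x))).
    by apply/funext => x; rewrite -Re_sum -fE.
  rewrite mean_sum; last by move=> p; exact: cont_Re_term.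
  by apply: eq_bigr => p _; exact: mean_Re_term.
rewrite mulr_sumr; apply: eq_bigr => -[z m] _ /=; have [->|m0] := eqVneq m 0.
  rewrite mulrC -meanZ//; apply: eq_mean => x.
  rewrite /F mul0r expi0 mulr1; case: (z) => zr zi /=;
  by rewrite mul0r subr0 mulrC.
rewrite mulr0; apply: mean_tpoly (tPs (z, m)) _ => -[u [v [/= ud -> e]]].
have : (`|m| * M <= d)%N.
  by have -> : (`|m| * M = `|u|)%N; [rewrite -[M]/(`|M%:Z|)%N -abszM; lia|].
by have : (0 < `|m|)%N; [rewrite absz_gt0|nia].
Qed.

(** The Newton-Schulz iteration q -> (3q - q^3)/2 for the sign function, started at the identity. *)
Definition smoothstep (k : nat) : {poly R} :=
  iter k (fun q => (3 / 2) *: q - 2^-1 *: q ^+ 3) 'X.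

Lemma smoothstepS k (t : R) : (smoothstep k.+1).[t] =
  (smoothstep k).[t] * (3 - (smoothstep k).[t] ^+ 2) / 2.
Proof.
rewrite {1}/smoothstep iterS -/(smoothstep k) hornerD hornerN !hornerZ horner_exp.
by field.
Qed.

(** If w' follows w, then 1 - w'^2 = (1 - w^2)^2 (4 - w^2)/4, so the defect is at least squared at
    each step; and w' t = w t + w t (1 - w^2)/2, so the product with [t] never decreases. *)
Lemma smoothstep_bound k (t : R) : t ^+ 2 <= 1 -> [/\ (smoothstep k).[t] ^+ 2 <= 1,
  t ^+ 2 <= (smoothstep k).[t] * t &
  1 - (smoothstep k).[t] ^+ 2 <= (1 - t ^+ 2) ^+ (2 ^ k)].
Proof.
move=> t1; elim: k => [|k [IH1 IH2 IH3]].
  by rewrite /= hornerX expr1 -expr2.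
rewrite smoothstepS; set w := _.[t] in IH1 IH2 IH3 *.
have e : 1 - (w * (3 - w ^+ 2) / 2) ^+ 2 = (1 - w ^+ 2) ^+ 2 * ((4 - w ^+ 2) / 4) by field.
have w0 := sqr_ge0 w; have s0 := sqr_ge0 (1 - w ^+ 2).
split.
- rewrite -subr_ge0 e mulr_ge0// divr_ge0//; lra.
- have t0 := sqr_ge0 t; have wt : 0 <= w * t by exact: le_trans IH2.
  have : 0 <= w * t * ((1 - w ^+ 2) / 2) by rewrite mulr_ge0// divr_ge0// subr_ge0.
  lra.
- rewrite e expnS mulnC exprM; apply: (@le_trans _ _ ((1 - w ^+ 2) ^+ 2)).
    by rewrite ler_piMr//; lra.
  by rewrite lerXn2r ?nnegrE ?subr_ge0// (le_trans _ IH3) ?subr_ge0.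
Qed.

Lemma cos2_le1 (x : R) : cos x ^+ 2 <= 1.
Proof. by rewrite -(cos2Dsin2 x) lerDl sqr_ge0. Qed.

Lemma cont_cosX n : continuous (fun x : R => cos x ^+ n).
Proof. by apply: contX; exact: continuous_cos. Qed.

Lemma cont_sinX n : continuous (fun x : R => sin x ^+ n).
Proof. by apply: contX; exact: continuous_sin. Qed.

(** Wallis' recursion, from the derivative of the periodic function cos sin^(2n+1). *)
Lemma mean_sinXS (a : R) n : (n.*2.+2)%:R * mean a (fun x => sin x ^+ n.*2.+2) =
  n.*2.+1%:R * mean a (fun x => sin x ^+ n.*2).
Proof.
have cs := cont_sinX.
have H : mean a (fun x => n.*2.+1%:R * sin x ^+ n.*2 +
    - n.*2.+2%:R * sin x ^+ n.*2.+2) = 0.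
  apply: (@mean_derive _ a (fun x => cos x * sin x ^+ n.*2.+1)).
  - have -> : (fun x : R => cos x * sin x ^+ n.*2.+1) = (@cos R) * (@sin R) ^+ n.*2.+1.
      by apply/funext => y; rewrite !fctE.
    move=> x; have := is_deriveM (is_derive_cos x) (is_deriveX n.*2.+1 (is_derive_sin x)).
    move/is_derive_eq; apply; rewrite /GRing.scale /= fctE !exprS -!natr1.
    have := cos2Dsin2 x => /(congr1 (fun y => y - sin x ^+ 2)); rewrite addrK => ce.
    transitivity (n.*2.+1%:R * cos x ^+ 2 * sin x ^+ n.*2 - sin x ^+ 2 * sin x ^+ n.*2).
      by rewrite -!natr1; ring.
    by rewrite ce -!natr1; ring.
  - by apply: contD; exact: contZ.
  - by rewrite mulr_natl cosD2pi sinD2pi.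
move: H; rewrite meanD; [|exact: contZ|exact: contZ].
by rewrite !meanZ// mulNr => /eqP; rewrite subr_eq0 => /eqP.
Qed.

(** The left side does not increase with [n], because (2n+1)(2n+3) <= (2n+2)^2. It gives the decay
    1/sqrt(2n+1) of the mean. *)
Lemma mean_sinX_sqr_le (a : R) n :
  n.*2.+1%:R * mean a (fun x => sin x ^+ n.*2) ^+ 2 <= 1.
Proof.
elim: n => [|n IH].
  by under eq_mean do rewrite expr0; rewrite mean_cst expr1n mulr1.
have H := mean_sinXS a n; rewrite doubleS.
move: H IH; set p := mean _ _; set q := mean _ _ => H IH.
have k0 : 0 < (n.*2.+2%:R : R) by rewrite ltr0n.
have pE : p = n.*2.+1%:R / n.*2.+2%:R * q.
  by rewrite mulrAC -H [_ * p]mulrC mulfK ?gt_eqF.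
rewrite pE exprMn mulrA.
have -> : n.*2.+3%:R * (n.*2.+1%:R / n.*2.+2%:R) ^+ 2 * q ^+ 2 =
    (n.*2.+3%:R * n.*2.+1%:R / n.*2.+2%:R ^+ 2) * (n.*2.+1%:R * q ^+ 2) :> R.
  by rewrite expr_div_n; ring.
have q0 : 0 <= n.*2.+1%:R * q ^+ 2 by rewrite mulr_ge0 ?sqr_ge0 ?ler0n.
apply: le_trans IH; rewrite ler_piMl// ler_pdivrMr ?exprn_gt0// mul1r.
by rewrite -!natrM -natrX ler_nat; nia.
Qed.

Lemma mean_cos_sqr (a : R) : mean a (fun x => cos x ^+ 2) = 2^-1.
Proof.
have H := mean_sinXS a 0.
have -> : (fun x : R => cos x ^+ 2) = (fun x => 1 + - 1 * sin x ^+ 2).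
  by apply/funext => x; have := cos2Dsin2 x; lra.
rewrite meanD; [|exact: cont_cst|by apply: contZ; exact: cont_sinX].
rewrite meanZ; last exact: cont_sinX.
move: H; rewrite /= double0 mean_cst.
lra.
Qed.

Lemma mean_cos (a : R) : mean a (@cos R) = 0.
Proof.
by have := @mean_cosM R a 1 isT; under eq_mean do rewrite mul1r.
Qed.

(** u = (1 + W)/2, with W a [smoothstep], imitates the indicator of t > 0. At t = cos y, u(1 - u) =
    (1 - W^2)/4 is at most sin^(2n) with n = 2^k, whose mean is small. Since W t >= t^2, the mean of
    u cos is at least half that of cos^2, a bound that does not depend on [eta]. *)
Lemma soft_step (eta : R) : 0 < eta -> exists u : {poly R},
  [/\ forall t : R, t ^+ 2 <= 1 -> 0 <= u.[t] <= 1,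
      forall a, mean a (fun y => u.[cos y] * (1 - u.[cos y])) <= eta &
      forall a, 4^-1 <= mean a (fun y => u.[cos y] * cos y)].
Proof.
move=> eta0.
have [k Hk] : exists k, 1 <= ((2 ^ k).*2.+1)%:R * eta ^+ 2.
  have h : 0 <= (eta ^+ 2)^-1 by rewrite invr_ge0 sqr_ge0.
  exists (Num.bound (eta ^+ 2)^-1); rewrite -ler_pdivrMr ?exprn_gt0// mul1r.
  apply: (le_trans (ltW (archi_boundP h))); rewrite ler_nat.
  by set b := Num.bound _; have := ltn_expl b (isT : (1 < 2)%N); lia.
pose W := smoothstep k; pose u := 2^-1 *: (1 + W); exists u.
have uE t : u.[t] = (1 + W.[t]) / 2.
  by rewrite /u hornerZ hornerD hornerC mulrC.
have cpoly (q : {poly R}) : continuous (fun y => q.[cos y]).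
  by have [D tD] := tdeg_poly_cos q; exact: tdeg_cont tD.
split.
- move=> t /(smoothstep_bound k)[W1 _ _]; rewrite uE -/W.
  move: W1; rewrite -/W; set w := W.[t] => W1.
  by apply/andP; split; nra.
- move=> a; pose n := (2 ^ k)%N.
  have q0 : 0 <= mean a (fun x => sin x ^+ n.*2).
    by apply: mean_ge0 => x; rewrite -mul2n exprM exprn_ge0// sqr_ge0.
  have qeta : mean a (fun x => sin x ^+ n.*2) <= eta.
    rewrite leNgt; apply/negP => lt_eta.
    have := mean_sinX_sqr_le a n; apply/negP; rewrite -ltNge.
    apply: (le_lt_trans Hk); rewrite ltr_pM2l ?ltr0n//.
    by rewrite ltr_pXn2r ?nnegrE ?(ltW eta0).
  apply: le_trans qeta; apply: le_mean.
  + by apply: contM => //; apply: contD; [exact: cont_cst|apply: contN].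
  + exact: cont_sinX.
  + move=> y; rewrite uE; have [W1 _ W3] := smoothstep_bound k (cos2_le1 y).
    rewrite -mul2n exprM -/n sin2cos2.
    have : 0 <= 1 - W.[cos y] ^+ 2 by rewrite subr_ge0.
    move: W3; rewrite -/W; set w := W.[_]; set s := _ ^+ n; lra.
- move=> a; have -> : (fun y => u.[cos y] * cos y) =
      (fun y => 2^-1 * cos y + 2^-1 * (W.[cos y] * cos y)).
    by apply/funext => y; rewrite uE; field.
  have c1 : continuous (fun y : R => W.[cos y] * cos y).
    by apply: contM => //; exact: continuous_cos.
  rewrite meanD; [|by apply: contZ; exact: continuous_cos|exact: contZ].
  rewrite !meanZ //; last exact: continuous_cos.
  rewrite mean_cos mulr0 add0r.
  have : mean a (fun x => cos x ^+ 2) <= mean a (fun y => W.[cos y] * cos y).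
    apply: le_mean => //; first exact: cont_cosX.
    by move=> y; have [_ + _] := smoothstep_bound k (cos2_le1 y).
  by rewrite mean_cos_sqr; lra.
Qed.

End soft_sign.

(** * The tree construction *)

Section tree.
Variables (R : realType) (u : {poly R}) (D : nat) (b : nat -> nat).
Hypothesis u01 : forall t : R, t ^+ 2 <= 1 -> 0 <= u.[t] <= 1.

(* Node [j] of the binary tree, in heap numbering (children [2 j] and [2 j + 1]),
   carries the frequency [4 b_j] and the weight [node_weight j]. *)
Definition freq j : nat := 4 * b j.
Definition go_right j (x : R) : R := u.[cos ((freq j)%:R * x)].
Definition wave j (x : R) : R := cos ((freq j)%:R * x).

(** A product along the path from the root. [fuel] makes the recursion on [j./2] structural; by
    [weight_rec_fuel] its value is immaterial from [j] on. *)
Fixpoint weight_rec (fuel j : nat) (x : R) : R :=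
  if fuel is f.+1 then
    if (j <= 1)%N then 1
    else weight_rec f j./2 x * (if odd j then go_right j./2 x else 1 - go_right j./2 x)
  else 1.
Definition node_weight j := weight_rec j j.

Lemma weight_rec_fuel f f' j x : (j <= f)%N -> (j <= f')%N ->
  weight_rec f j x = weight_rec f' j x.
Proof.
elim: f f' j => [|f IH] [|f'] j //=.
- by rewrite leqn0 => /eqP ->.
- by move=> _; rewrite leqn0 => /eqP ->.
- move=> jf jf'; case: leqP => // j1; congr (_ * _); apply: IH; lia.
Qed.

Lemma weight_recS f j x : (1 < j)%N -> weight_rec f.+1 j x =
  weight_rec f j./2 x * (if odd j then go_right j./2 x else 1 - go_right j./2 x).
Proof. by move=> j1; rewrite /= leqNgt j1. Qed.

Lemma node_weight1 x : node_weight 1 x = 1. Proof. by []. Qed.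

Lemma node_weight_double j x : (0 < j)%N ->
  node_weight j.*2 x = node_weight j x * (1 - go_right j x).
Proof.
move=> j0; rewrite /node_weight (@weight_rec_fuel _ j.*2.+1 j.*2)// weight_recS; last lia.
by rewrite doubleK odd_double; congr (_ * _); apply: weight_rec_fuel; lia.
Qed.

Lemma node_weight_doubleS j x : (0 < j)%N ->
  node_weight j.*2.+1 x = node_weight j x * go_right j x.
Proof.
move=> j0; rewrite /node_weight weight_recS; last lia.
rewrite (_ : j.*2.+1./2 = j); last by lia.
by rewrite oddS odd_double; congr (_ * _); apply: weight_rec_fuel; lia.
Qed.

Lemma node_ind (P : nat -> Prop) : P 1%N ->
  (forall j, (0 < j)%N -> P j -> P j.*2 /\ P j.*2.+1) -> forall j, (0 < j)%N -> P j.
Proof.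
move=> P1 PS j; elim/ltn_ind: j => -[|[|j]] // IH _.
have j0 : (0 < j./2.+1)%N by [].
have jl : (j./2.+1 < j.+2)%N by lia.
have [P2 P3] := PS _ j0 (IH _ jl j0).
have [->|->] : j.+2 = j./2.+1.*2 \/ j.+2 = j./2.+1.*2.+1 by lia.
  exact: P2.
exact: P3.
Qed.

Lemma go_right_bound j x : 0 <= go_right j x <= 1.
Proof. by apply: u01; exact: cos2_le1. Qed.

Lemma node_weight_bound j x : (0 < j)%N -> 0 <= node_weight j x <= 1.
Proof.
move: j; apply: node_ind => [|j j0 /andP[IH0 IH1]]; first by rewrite node_weight1 ler01 lexx.
rewrite node_weight_double// node_weight_doubleS//.
have /andP[g0 g1] := go_right_bound j x.
move: IH0 IH1 g0 g1; set w := node_weight j x; set g := go_right j x => *.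
by split; apply/andP; split; nra.
Qed.

Fixpoint inorder (n j : nat) : seq nat :=
  if n is n'.+1 then inorder n' j.*2 ++ j :: inorder n' j.*2.+1 else [::].

(** In heap numbering the k-th generation below [j] fills the interval from 2^k j to 2^k (j+1) - 1;
    these intervals separate the two subtrees in [inorder_uniq]. *)
Lemma inorderP n j i : i \in inorder n j ->
  exists2 k, (k < n)%N & (2 ^ k * j <= i < 2 ^ k * j.+1)%N.
Proof.
elim: n j => //= n IH j; rewrite mem_cat inE => /or3P[/IH[k kn H]|/eqP ->|/IH[k kn H]].
- by exists k.+1 => //; rewrite expnS; nia.
- by exists 0%N => //; rewrite expn0 !mul1n leqnn ltnSn.
- by exists k.+1 => //; rewrite expnS; nia.
Qed.

Lemma inorder_gt0 n j i : (0 < j)%N -> i \in inorder n j -> (0 < i)%N.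
Proof.
move=> j0 /inorderP[k _ /andP[H _]]; apply: leq_trans H.
by rewrite muln_gt0 expn_gt0 j0.
Qed.

Lemma inorder_uniq n j : (0 < j)%N -> uniq (inorder n j).
Proof.
elim: n j => //= n IH j j0; rewrite cat_uniq /= !IH; [|lia|lia].
rewrite /= andbT; apply/andP; split.
- apply/norP; split.
    by apply/negP => /inorderP[k _]; have := expn_gt0 2 k; nia.
  apply/hasPn => i /inorderP[k _ ik]; apply/negP => /inorderP[k' _ ik'].
  have [kk|kk|kk] := ltngtP k k'.
  + have : (2 ^ k.+1 <= 2 ^ k')%N by rewrite leq_exp2l.
    rewrite expnS; nia.
  + have : (2 ^ k'.+1 <= 2 ^ k)%N by rewrite leq_exp2l.
    rewrite expnS; nia.
  + by rewrite kk in ik; nia.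
- by apply/negP => /inorderP[k _]; have := expn_gt0 2 k; nia.
Qed.

(** The weights of two children add up to that of the parent, so each of the [n] levels contributes
    [node_weight j]. *)
Lemma sum_inorder_weight n j x : (0 < j)%N ->
  \sum_(i <- inorder n j) node_weight i x = n%:R * node_weight j x.
Proof.
elim: n j => [|n IH] j j0 /=; first by rewrite big_nil mul0r.
rewrite big_cat big_cons /= !IH; [|lia|lia].
by rewrite node_weight_double// node_weight_doubleS// -natr1; ring.
Qed.

(** [gain] is the contribution of a right turn at [i]. [loss] vanishes when [go_right] is 0 or 1 and
    measures the indecision due to smoothing. *)
Definition gain x (i : nat) : R := node_weight i x * go_right i x * wave i x.
Definition loss x (i : nat) : R := node_weight i x * (go_right i x * (1 - go_right i x)).

Lemma wave_bound i x : -1 <= wave i x <= 1.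
Proof. by rewrite cos_geN1 cos_le1. Qed.

Lemma loss_ge0 i x : (0 < i)%N -> 0 <= loss x i.
Proof.
move=> i0; have /andP[w0 _] := node_weight_bound x i0.
by have /andP[g0 g1] := go_right_bound i x; rewrite !mulr_ge0 ?subr_ge0.
Qed.

Lemma gain_le i x : (0 < i)%N -> gain x i <= node_weight i x.
Proof.
move=> i0; have /andP[w0 _] := node_weight_bound x i0.
have /andP[g0 g1] := go_right_bound i x; have /andP[c0 c1] := wave_bound i x.
rewrite /gain -mulrA ler_piMr//.
move: g0 g1 c0 c1; set g := go_right _ _; set c := wave _ _ => *; nra.
Qed.

Lemma gain_le_wave i x : (0 < i)%N ->
  gain x i <= node_weight i x * wave i x + node_weight i x * (1 - go_right i x).
Proof.
move=> i0; have /andP[w0 _] := node_weight_bound x i0.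
have /andP[g0 g1] := go_right_bound i x; have /andP[c0 c1] := wave_bound i x.
rewrite /gain -mulrA -mulrDr ler_wpM2l//.
move: g0 g1 c0 c1; set g := go_right _ _; set c := wave _ _ => *; nra.
Qed.

Lemma gain_le_wave_weight i x : (0 < i)%N ->
  gain x i <= node_weight i x * wave i x + node_weight i x.
Proof.
move=> i0; have /andP[w0 _] := node_weight_bound x i0.
have /andP[g0 g1] := go_right_bound i x.
apply: le_trans (gain_le_wave x i0) _; rewrite lerD2l ler_piMr//; lra.
Qed.

(* Descend to the right exactly when [go_right >= 1/2]: the nodes to the left of
   the leaf reached are essentially those where the path turned right. *)
Lemma prefix_gain n j x : (0 < j)%N -> exists2 k, (k <= size (inorder n j))%N &
  \sum_(i <- inorder n j) gain x i - 2 * n%:R * \sum_(i <- inorder n j) loss x i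
    <= \sum_(i <- take k (inorder n j)) node_weight i x * wave i x.
Proof.
elim: n j => [|n IH] j j0 /=.
  by exists 0%N => //; rewrite !big_nil; lra.
have j2 : (0 < j.*2)%N by lia.
have j3 : (0 < j.*2.+1)%N by lia.
set L := inorder n j.*2; set S := inorder n j.*2.+1.
have L0 i : i \in L -> (0 < i)%N by exact: inorder_gt0.
have S0 i : i \in S -> (0 < i)%N by exact: inorder_gt0.
have lossL : 0 <= \sum_(i <- L) loss x i.
  by rewrite big_seq sumr_ge0// => i /L0; exact: loss_ge0.
have lossS : 0 <= \sum_(i <- S) loss x i.
  by rewrite big_seq sumr_ge0// => i /S0; exact: loss_ge0.
have lossj := loss_ge0 x j0.
have /andP[w0 _] := node_weight_bound x j0.
have /andP[g0 g1] := go_right_bound j x.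
have sumL := sum_inorder_weight n x j2; have sumS := sum_inorder_weight n x j3.
rewrite -/L node_weight_double// in sumL; rewrite -/S node_weight_doubleS// in sumS.
have n0 : 0 <= n%:R :> R by [].
rewrite !big_cat !big_cons /= -natr1.
have [half|half] := leP (1 / 2) (go_right j x).
- have [k kS Hk] := IH _ j3; rewrite -/S in kS Hk.
  exists (size L + k.+1)%N; first by rewrite size_cat leq_add2l.
  rewrite take_cat ltnNge leq_addr /= addKn /= big_cat big_cons /=.
  have HL : \sum_(i <- L) gain x i <=
      \sum_(i <- L) node_weight i x * wave i x + \sum_(i <- L) node_weight i x.
    rewrite -big_split /= big_seq [leRHS]big_seq; apply: ler_sum => i /L0.
    exact: gain_le_wave_weight.
  have Hj := gain_le_wave x j0.
  (* Going right puts the whole left subtree in the prefix, which costs at most its total weight n w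
     (1-g), and node [j] costs at most w (1-g). As 2g >= 1, both are covered by the term of
     [loss x j]. *)
  have lj : (n%:R + 1) * (node_weight j x * (1 - go_right j x)) <=
      2 * (n%:R + 1) * loss x j.
    rewrite /loss [2 * _]mulrC -mulrA ler_wpM2l ?addr_ge0//.
    rewrite mulrCA ler_wpM2l// mulrA ler_peMl ?subr_ge0//; lra.
  have nL := mulr_ge0 n0 lossL.
  move: Hk HL Hj lj nL lossL lossS lossj; rewrite sumL.
  set a1 := \sum_(i <- L) gain x i; set a2 := \sum_(i <- S) gain x i.
  set l1 := \sum_(i <- L) loss x i; set l2 := \sum_(i <- S) loss x i.
  lra.
- have [k kL Hk] := IH _ j2; rewrite -/L in kL Hk.
  exists k; first by rewrite size_cat (leq_trans kL)// leq_addr.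
  rewrite takel_cat//.
  have HS : \sum_(i <- S) gain x i <= \sum_(i <- S) node_weight i x.
    by rewrite big_seq [leRHS]big_seq; apply: ler_sum => i /S0; exact: gain_le.
  have Hj : gain x j <= node_weight j x * go_right j x.
    have /andP[_ c1] := wave_bound j x.
    by rewrite /gain ler_piMr// mulr_ge0.
  (* Going left abandons the gains of [j] and of the right subtree, at most (n+1) w g in all; now
     2(1-g) >= 1. *)
  have lj : (n%:R + 1) * (node_weight j x * go_right j x) <=
      2 * (n%:R + 1) * loss x j.
    rewrite /loss [2 * _]mulrC -mulrA ler_wpM2l ?addr_ge0//.
    rewrite mulrCA ler_wpM2l// mulrA mulrAC ler_peMl//; lra.
  have nS := mulr_ge0 n0 lossS.
  move: Hk HS Hj lj nS lossL lossS lossj; rewrite sumS.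
  set a1 := \sum_(i <- L) gain x i; set a2 := \sum_(i <- S) gain x i.
  set l1 := \sum_(i <- L) loss x i; set l2 := \sum_(i <- S) loss x i.
  lra.
Qed.

Hypothesis tdeg_u : tdeg D (fun y => u.[cos y]).
Hypothesis b_growth : forall j, (b j * (5 + 4 * D) <= b j.+1)%N.

Lemma b_lt i j : (i < j)%N -> (b i * (5 + 4 * D) <= b j)%N.
Proof.
elim: j => // j IH; rewrite ltnS leq_eqVlt => /orP[/eqP ->|ij]; first exact: b_growth.
by have := IH ij; have := b_growth j; nia.
Qed.

Lemma tdeg_go_right j : tdeg (D * freq j) (go_right j).
Proof. exact: (tdeg_dilate (freq j) tdeg_u). Qed.

(** A child has degree at most b_j + 4 D b_j, which the growth factor 5 + 4 D of [b] absorbs. *)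
Lemma tdeg_node_weight j : (0 < j)%N -> tdeg (b j) (node_weight j).
Proof.
move: j; apply: node_ind => [|j j0 IH]; first exact: tdegS (tdeg_cst 1).
have tg := tdeg_go_right j.
have t1g : tdeg (D * freq j) (fun x => 1 - go_right j x).
  apply: tdegD; first exact: tdegS (tdeg_cst 1).
  have := tdegM (tdeg_cst (-1)) tg; rewrite add0n.
  by apply: eq_tpoly => x; rewrite mulN1r.
have lt1 : (b j * (5 + 4 * D) <= b j.*2)%N by apply: b_lt; lia.
have lt2 : (b j * (5 + 4 * D) <= b j.*2.+1)%N by apply: b_lt; lia.
split.
- have -> : node_weight j.*2 = (fun x => node_weight j x * (1 - go_right j x)).
    by apply/funext => x; rewrite node_weight_double.
  by apply: tdegS (tdegM IH t1g); rewrite /freq; nia.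
- have -> : node_weight j.*2.+1 = (fun x => node_weight j x * go_right j x).
    by apply/funext => x; rewrite node_weight_doubleS.
  by apply: tdegS (tdegM IH tg); rewrite /freq; nia.
Qed.

End tree.

(** * Means and orthogonality over the tree *)

Section moments.
Variables (R : realType) (u : {poly R}) (D : nat) (b : nat -> nat).
Hypothesis u01 : forall t : R, t ^+ 2 <= 1 -> 0 <= u.[t] <= 1.
Hypothesis tdeg_u : tdeg D (fun y => u.[cos y]).
Hypothesis tdeg_ucos : tdeg D (fun y => u.[cos y] * cos y).
Hypothesis b_gt0 : forall j, (0 < b j)%N.
Hypothesis b_growth : forall j, (b j * (5 + 4 * D) <= b j.+1)%N.

Local Notation weight := (node_weight u b).
Let alpha : R := mean 0 (fun y => u.[cos y] * cos y).

Lemma tdeg_weight i : (0 < i)%N -> tdeg (b i) (weight i).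
Proof. exact: tdeg_node_weight tdeg_u b_growth i. Qed.

Lemma b_lt_freq i : (b i < freq b i)%N.
Proof. by rewrite /freq; have := b_gt0 i; lia. Qed.

Lemma cont_weight i : (0 < i)%N -> continuous (weight i).
Proof. by move=> i0; exact: tdeg_cont (tdeg_weight i0). Qed.

Lemma tdeg_spread : tdeg (D + D) (fun y => u.[cos y] * (1 - u.[cos y])).
Proof.
apply: tdegM => //; apply: tdegD; first exact: tdegS (tdeg_cst 1).
have := tdegM (tdeg_cst (-1)) tdeg_u; rewrite add0n.
by apply: eq_tpoly => x; rewrite mulN1r.
Qed.

Lemma mean_loss a i : (0 < i)%N -> mean a (fun x => loss u b x i) =
  mean a (weight i) * mean 0 (fun y => u.[cos y] * (1 - u.[cos y])).
Proof. by move=> i0; exact: mean_indep (tdeg_weight i0) tdeg_spread (b_lt_freq i). Qed.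

Lemma tdeg_centered : tdeg D (fun y => u.[cos y] * cos y - alpha).
Proof. by apply: tdegD => //; exact: tdegS (tdeg_cst _). Qed.

Lemma mean_centered : mean 0 (fun y => u.[cos y] * cos y - alpha) = 0.
Proof.
rewrite meanD; [|exact: tdeg_cont tdeg_ucos|exact: cont_cst].
by rewrite mean_cst subrr.
Qed.

Lemma ucos_bound (y : R) : -1 <= u.[cos y] * cos y <= 1.
Proof.
have /andP[u0 u1] := u01 (cos2_le1 y).
have c0 := cos_geN1 y; have c1 := cos_le1 y.
by apply/andP; split; nra.
Qed.

Lemma alpha_bound : -1 <= alpha <= 1.
Proof.
have c := tdeg_cont tdeg_ucos.
apply/andP; split.
- apply: (@le_trans _ _ (mean 0 (fun=> - 1))); first by rewrite mean_cst.
  by apply: le_mean => [||y]; [exact: cont_cst|exact: c|have /andP[] := ucos_bound y].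
- apply: (@le_trans _ _ (mean 0 (fun=> 1))); last by rewrite mean_cst.
  by apply: le_mean => [||y]; [exact: c|exact: cont_cst|have /andP[] := ucos_bound y].
Qed.

(** Plays the part of a martingale difference: by [deviationE] it is the weight times a centered
    function of a much faster angle. *)
Definition deviation x i : R := gain u b x i - alpha * weight i x.

Lemma deviationE x i : deviation x i =
  weight i x * (u.[cos ((freq b i)%:R * x)] * cos ((freq b i)%:R * x) - alpha).
Proof. by rewrite /deviation /gain /go_right /wave; ring. Qed.

Lemma tdeg_deviation i : (0 < i)%N ->
  tdeg (b i + D * freq b i) (fun x => deviation x i).
Proof.
move=> i0; have := tdegM (tdeg_weight i0) (tdeg_dilate (freq b i) tdeg_centered).
by apply: eq_tpoly => x; rewrite deviationE.
Qed.

Lemma cont_deviation i : (0 < i)%N -> continuous (fun x => deviation x i).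
Proof. by move=> i0; exact: tdeg_cont (tdeg_deviation i0). Qed.

(** For i < j, the product of [deviation x i] and the weight of [j] has degree below [freq b j], so
    it is independent of the centered factor at [j]. *)
Lemma mean_deviationM a i j : (0 < i)%N -> (0 < j)%N -> i != j ->
  mean a (fun x => deviation x i * deviation x j) = 0.
Proof.
wlog ij : i j / (i < j)%N.
  move=> H i0 j0 nij; have [ij|ij] := ltnP i j; first exact: H.
  under eq_mean do rewrite mulrC.
  by apply: H => //; [rewrite ltn_neqAle eq_sym nij|rewrite eq_sym].
move=> i0 j0 _.
have tP := tdegM (tdeg_deviation i0) (tdeg_weight j0).
have bij := b_lt b_growth ij; have bj := b_gt0 j.
have dM : (b i + D * freq b i + b j < freq b j)%N by rewrite /freq; nia.
have := mean_indep a 0 tP tdeg_centered dM; rewrite mean_centered mulr0 => <-.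
by apply: eq_mean => x; rewrite -mulrA [in LHS](deviationE x j).
Qed.

Lemma mean_deviation_sqr a i : (0 < i)%N ->
  mean a (fun x => deviation x i ^+ 2) <= 4 * mean a (weight i).
Proof.
move=> i0; rewrite -meanZ; last exact: cont_weight.
apply: le_mean; [by apply: contX; exact: cont_deviation|by apply: contZ; exact: cont_weight|].
move=> x; rewrite deviationE.
have /andP[w0 w1] := node_weight_bound b u01 x i0.
have /andP[v0 v1] := ucos_bound ((freq b i)%:R * x).
have /andP[a0 a1] := alpha_bound.
move: w0 w1 v0 v1; set w := weight i x; set v := _ * cos _ => *.
rewrite exprMn mulrC; apply: ler_pM; rewrite ?sqr_ge0//; nra.
Qed.

(** Only diagonal terms survive. For the full tree of depth N the bound is 4N, small against the
    square of the total gain, which is of order N^2: this is a weak law of large numbers. *)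
Lemma mean_sum_deviation_sqr a (s : seq nat) : uniq s -> {in s, forall i, (0 < i)%N} ->
  mean a (fun x => (\sum_(i <- s) deviation x i) ^+ 2)
    <= 4 * \sum_(i <- s) mean a (weight i).
Proof.
move=> us s0.
have cdv i : i \in s -> continuous (fun x => deviation x i).
  by move=> /s0; exact: cont_deviation.
have -> : (fun x => (\sum_(i <- s) deviation x i) ^+ 2) =
    (fun x => \sum_(i <- s) \sum_(j <- s) deviation x i * deviation x j).
  apply/funext => x; rewrite expr2 big_distrl /=; apply: eq_bigr => i _.
  by rewrite big_distrr.
rewrite (@mean_sum_seq _ a _ s (fun i x => \sum_(j <- s) deviation x i * deviation x j)); last first.
  by move=> i is_; apply: cont_sum_seq => j js; apply: contM; exact: cdv.
rewrite mulr_sumr big_seq [leRHS]big_seq; apply: ler_sum => i is_.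
rewrite (@mean_sum_seq _ a _ s (fun j x => deviation x i * deviation x j)); last first.
  by move=> j js; apply: contM; exact: cdv.
have i0 := s0 _ is_.
rewrite (bigD1_seq i)//= big_seq_cond big1 ?addr0 => [|j /andP[js ji]].
  exact: mean_deviation_sqr.
by apply: mean_deviationM => //; [exact: s0|rewrite eq_sym].
Qed.

End moments.

(** * A finite block with large partial sums off a small set *)

Section blocks.
Variable R : realType.
Implicit Types (c : int -> R[i]) (E F : {fset int}).

Lemma tpoly_coef (A : set int) (f : R -> R[i]) : tpoly A f ->
  exists (cE : (int -> R[i]) * {fset int}),
    (forall m, m \in cE.2 -> A m) /\ f =1 trig_sum cE.1 cE.2.
Proof.
move=> [s sA fE].
exists (fun m => \sum_(p <- s | p.2 == m) p.1, [fset p.2 | p in s]%fset) => /=; split.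
  by move=> m /imfsetP[p /= ps ->]; exact: sA.
move=> x; rewrite fE /trig_sum.
under [RHS]eq_bigr => m _ do rewrite mulr_suml big_mkcond.
rewrite exchange_big /= big_seq [RHS]big_seq; apply: eq_bigr => p ps.
have pE : p.2 \in [fset p.2 | p in s]%fset by apply/imfsetP; exists p.
rewrite (bigD1_seq p.2 pE (fset_uniq _)) /= eqxx big1 ?addr0// => m mp.
by rewrite eq_sym (negbTE mp).
Qed.

Lemma sum_fsetU (V : zmodType) E F (h : int -> V) :
  (forall m, m \in E -> m \notin F) ->
  \sum_(m <- (E `|` F)%fset) h m = \sum_(m <- E) h m + \sum_(m <- F) h m.
Proof.
move=> EF; rewrite (big_fsetID _ (fun m => m \in E)) /=.
have -> : ([fset m in E `|` F | m \in E] = E)%fset.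
  apply/fsetP => m; rewrite !inE; case: (m \in E) => //; by rewrite andbF.
have -> : ([fset m in E `|` F | m \notin E] = F)%fset; last by [].
apply/fsetP => m; rewrite !inE; have [/EF/negbTE ->//|_] := boolP (m \in E).
by rewrite /= andbT.
Qed.

Lemma sum_bigfcup (V : zmodType) (s : seq nat) (E : nat -> {fset int}) (h : int -> V) :
  uniq s -> {in s &, forall i j, i != j -> forall m, m \in E i -> m \notin E j} ->
  \sum_(m <- (\bigcup_(i <- s) E i)%fset) h m = \sum_(i <- s) \sum_(m <- E i) h m.
Proof.
elim: s => [|i s IH] /=; first by rewrite !big_nil ?big_seq_fset0.
move=> /andP[nis us] dis; rewrite !big_cons sum_fsetU ?IH//.
  by move=> j k js ks; apply: dis; rewrite inE ?js ?ks orbT.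
move=> m mi; apply/negP => /bigfcupP[j]; rewrite andbT => js.
apply/negP; apply: dis mi; rewrite ?inE ?eqxx ?js ?orbT//.
by apply: contraNneq nis => ->.
Qed.

Lemma window_bounds (B : nat) (m : int) :
  (`|(m - (4 * B)%N%:Z)%R| <= B)%N -> 3 * B%:Z <= m <= 5 * B%:Z.
Proof. lia. Qed.

Lemma windows_disjoint (B B' D : nat) (m : int) : (0 < B)%N -> (B * (5 + 4 * D) <= B')%N ->
  m <= 5 * B%:Z -> 3 * B'%:Z <= m -> False.
Proof.
move=> B0; rewrite mulnDr => /(leq_trans (leq_addr _ _)) BB' mB mB'; lia.
Qed.

(* [bl_bad] is at least 1 off the set where some partial sum along the chain
   exceeds 1; its small mean makes the rest of the period small. *)
Record block := Block {
  bl_coef : int -> R[i];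
  bl_chain : nat -> {fset int};
  bl_len : nat;
  bl_end : nat;
  bl_bad : R -> R }.

Definition block_spec (eps : R) (L : nat) (B : block) : Prop :=
  [/\ [/\ bl_chain B 0 = fset0,
          forall k, (bl_chain B k `<=` bl_chain B k.+1)%fset &
          forall k, (bl_chain B k `<=` bl_chain B (bl_len B))%fset],
      forall m, m \in bl_chain B (bl_len B) -> L%:Z < m < (bl_end B)%:Z,
      mass (bl_coef B) (bl_chain B (bl_len B)) <= eps,
      [/\ continuous (bl_bad B), forall x, 0 <= bl_bad B x &
          forall a, mean a (bl_bad B) <= eps] &
      forall x, bl_bad B x < 1 -> exists2 k, (k <= bl_len B)%N &
        1 < nq (trig_sum (bl_coef B) (bl_chain B k) x)].

(** Scaling by kappa with kappa^2 = eps/N makes the mass at most kappa^2 N = eps, while the good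
    partial sum is at least kappa N/8, of square eps N/64 >= 32. *)
Lemma block_exists (eps : R) (L : nat) : 0 < eps -> exists B, block_spec eps L B.
Proof.
move=> eps0.
have [N N0 HN] : exists2 N : nat, (0 < N)%N & 2048 / eps <= N%:R.
  have h : 0 <= 2048 / eps by rewrite divr_ge0 ?ler0n// ltW.
  exists (Num.bound (2048 / eps)).+1 => //.
  by rewrite (le_trans (ltW (archi_boundP h)))// ler_nat.
have NR : 0 < (N%:R : R) by rewrite ltr0n.
have epsN : 2048 <= eps * N%:R by move: HN; rewrite ler_pdivrMr// mulrC.
(* The total loss has mean at most N eta; weighted by [K2] = 32 this is eps/2. *)
pose eta := eps / (64 * N%:R).
have eta0 : 0 < eta by rewrite divr_gt0 ?mulr_gt0 ?ltr0n.
have [u [u01 ueta ucos]] := soft_step eta0.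
have [D1 tu] := tdeg_poly_cos u.
have [D2 tuc] := tdeg_poly_cos (u * 'X).
pose D := maxn D1 D2.
have tdeg_u : tdeg D (fun y => u.[cos y]) by exact: tdegS (leq_maxl _ _) tu.
have tdeg_ucos : tdeg D (fun y => u.[cos y] * cos y).
  apply: tdegS (leq_maxr D1 D2) _; apply: eq_tpoly tuc => x.
  by rewrite hornerM hornerX.
(* The factor [L.+1] puts every frequency above [L]. *)
pose b j := (L.+1 * (5 + 4 * D) ^ j)%N.
have b_gt0 j : (0 < b j)%N by rewrite muln_gt0 expn_gt0.
have b_ge j : (L < b j)%N by rewrite /b -[X in (X <= _)%N]muln1 leq_mul ?expn_gt0.
have b_growth j : (b j * (5 + 4 * D) <= b j.+1)%N by rewrite /b expnSr mulnA.
clearbody b.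
pose s := inorder N 1.
have us : uniq s by exact: inorder_uniq.
have s0 : {in s, forall i, (0 < i)%N} by move=> i; exact: inorder_gt0.
pose w := node_weight u b.
pose kappa := Num.sqrt (eps / N%:R).
have kappa2 : kappa ^+ 2 = eps / N%:R by rewrite sqr_sqrtr// divr_ge0 ?(ltW eps0)// ltW.
pose f j x : R[i] := (kappa * w j x)%:C * expi ((freq b j)%:~R * x).
have tf j : (0 < j)%N -> tpoly [set m : int | (`|(m - (freq b j)%:Z)%R| <= b j)%N] (f j).
  move=> j0.
  have t1 := tpolyZ kappa%:C (tdeg_node_weight tdeg_u b_growth j0).
  have := tpolyM t1 (@tpoly1 R [set (freq b j)%:Z] 1 _ erefl).
  move=> /eq_tpoly-/(_ (f j))H; apply: tpolyS (H _) => [m [a [_ [/= ad -> ->]]]|x].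
    by rewrite addrK.
  by rewrite /f mul1r rmorphM.
have /choice[cE cEP] : forall j, exists ce : (int -> R[i]) * {fset int}, (0 < j)%N ->
    (forall m, m \in ce.2 -> (`|(m - (freq b j)%:Z)%R| <= b j)%N) /\
    f j =1 trig_sum ce.1 ce.2.
  move=> j; have [j0|j0] := boolP (0 < j)%N; last by exists (fun=> 0, fset0).
  by have [ce H] := tpoly_coef (tf j j0); exists ce.
pose E j := (cE j).2.
have window j m : j \in s -> m \in E j -> 3 * (b j)%:Z <= m <= 5 * (b j)%:Z.
  by move=> /s0 /cEP[H _] /H; exact: window_bounds.
(* Degree b_j around the frequency 4 b_j gives the window [3 b_j, 5 b_j], and [b] grows at least by
   the factor 5. *)
have dis : {in s &, forall i j, i != j -> forall m, m \in E i -> m \notin E j}.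
  move=> i j is_ js ij m /(window _ _ is_)/andP[mi mi']; apply/negP.
  move=> /(window _ _ js)/andP[mj mj']; move: ij; rewrite neq_ltn => /orP[] /(b_lt b_growth) bb.
    exact: windows_disjoint (b_gt0 i) bb mi' mj.
  exact: windows_disjoint (b_gt0 j) bb mj' mi.
pose c m : R[i] := \sum_(j <- s) if m \in E j then (cE j).1 m else 0.
have cEq j m : j \in s -> m \in E j -> c m = (cE j).1 m.
  move=> js mj; rewrite /c (bigD1_seq j)//= mj big_seq_cond big1 ?addr0// => i /andP[is_ ij].
  by rewrite eq_sym in ij; rewrite (negbTE (dis _ _ js is_ ij _ mj)).
pose H k := (\bigcup_(j <- take k s) E j)%fset.
have sumH (V : zmodType) (h : int -> V) k :
    \sum_(m <- H k) h m = \sum_(j <- take k s) \sum_(m <- E j) h m.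
  apply: sum_bigfcup; first exact: take_uniq.
  by move=> i j /mem_take is_ /mem_take js; exact: dis.
have trigH k x : trig_sum c (H k) x =
    \sum_(j <- take k s) (kappa * w j x)%:C * expi ((freq b j)%:~R * x).
  rewrite /trig_sum sumH big_seq [RHS]big_seq; apply: eq_bigr => j /mem_take js.
  have [_ /(_ x)] := cEP _ (s0 _ js); rewrite -/(f j x) => ->.
  by rewrite /trig_sum big_seq [RHS]big_seq; apply: eq_bigr => m mj; rewrite (cEq j).
have w01 j x : (0 < j)%N -> 0 <= w j x <= 1 by move=> j0; exact: node_weight_bound.
have cw j : (0 < j)%N -> continuous (w j) by move=> j0; exact: (cont_weight tdeg_u b_growth j0).
have sumw x : \sum_(j <- s) w j x = N%:R.
  by rewrite sum_inorder_weight// node_weight1 mulr1.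
have smean a : \sum_(j <- s) mean a (w j) = N%:R.
  rewrite -mean_sum_seq => [|j /s0]; last exact: cw.
  by rewrite -[RHS](mean_cst a); exact: eq_mean.
have massH : mass c (H (size s)) <= eps.
  rewrite /mass sumH take_size.
  apply: (@le_trans _ _ (\sum_(j <- s) kappa ^+ 2 * mean 0 (w j))).
    rewrite big_seq [leRHS]big_seq; apply: ler_sum => j js; have j0 := s0 _ js.
    have -> : \sum_(m <- E j) nq (c m) = \sum_(m <- E j) nq ((cE j).1 m).
      by rewrite big_seq [RHS]big_seq; apply: eq_bigr => m mj; rewrite (cEq j).
    rewrite -(parseval 0) -meanZ; last exact: cw.
    apply: le_mean; [exact: cont_trig_sum|by apply: contZ; exact: cw|] => x.
    have [_ <-] := cEP _ j0; rewrite /f nqM nq_expi mulr1 nqC exprMn.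
    have /andP[w0 w1] := w01 _ x j0.
    by rewrite ler_wpM2l ?sqr_ge0// expr2 ler_piMl.
  by rewrite -mulr_sumr smean kappa2 divfK// gt_eqF.
pose dev x := \sum_(j <- s) deviation u b x j.
pose lossN x := \sum_(j <- s) loss u b x j.
have cdev : continuous dev.
  by apply: cont_sum_seq => j /s0 j0; exact: (cont_deviation tdeg_u tdeg_ucos b_growth).
have closs j : (0 < j)%N -> continuous (fun x => loss u b x j).
  move=> j0; apply: contM; first exact: cw.
  have cg := tdeg_cont (tdeg_go_right b tdeg_u j).
  by apply: contM => //; apply: contD; [exact: cont_cst|exact: contN].
have clossN : continuous lossN by apply: cont_sum_seq => j /s0; exact: closs.
have lossN0 x : 0 <= lossN x.
  by rewrite /lossN big_seq sumr_ge0// => j /s0 j0; exact: loss_ge0.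
have mdev a : mean a (fun x => dev x ^+ 2) <= 4 * N%:R.
  by rewrite -(smean a); exact: (mean_sum_deviation_sqr u01 tdeg_u tdeg_ucos b_gt0 b_growth).
have mloss a : mean a lossN <= N%:R * eta.
  rewrite /lossN mean_sum_seq => [|j /s0]; last exact: closs.
  rewrite -(smean a) mulr_suml big_seq [leRHS]big_seq; apply: ler_sum => j /s0 j0.
  rewrite (mean_loss tdeg_u b_gt0 b_growth a j0) ler_wpM2l//.
  by apply: mean_ge0 => x; have /andP[] := w01 j x j0.
(* Chosen so that K1 dev^2 < 1 means |dev| < N/16 and K2 loss < 1 means 2 N loss < N/16. From a mean
   gain of at least N/4 there remains at least N/8. The mean of K1 dev^2 is at most 1024/N <= eps/2,
   whence the 2048 above. *)
pose K1 : R := 256 / N%:R ^+ 2; pose K2 : R := 32.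
have K10 : 0 < K1 by rewrite divr_gt0 ?exprn_gt0 ?ltr0n.
have K20 : 0 < K2 by rewrite ltr0n.
have Keps : K1 * (4 * N%:R) + K2 * (N%:R * eta) <= eps.
  have -> : K1 * (4 * N%:R) + K2 * (N%:R * eta) = 1024 / N%:R + eps / 2.
    by rewrite /K1 /K2 /eta; field; rewrite gt_eqF.
  have : 1024 / N%:R <= eps / 2 by rewrite ler_pdivrMr//; lra.
  lra.
have good x : K1 * dev x ^+ 2 < 1 -> K2 * lossN x < 1 ->
    exists2 k, (k <= size s)%N & 1 < nq (trig_sum c (H k) x).
  move=> dev1 loss1.
  have [k ks Hk] := prefix_gain b u01 N x (isT : (0 < 1)%N).
  exists k => //; rewrite -/s -/w in ks Hk.
  pose P := \sum_(i <- take k s) w i x * wave b i x.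
  have PE : complex.Re (trig_sum c (H k) x) = kappa * P.
    rewrite trigH Re_sum mulr_sumr; apply: eq_bigr => j _.
    by rewrite /= mul0r subr0 mulrA.
  have devN : - (N%:R / 16) < dev x.
    have : dev x ^+ 2 < (N%:R / 16) ^+ 2.
      move: dev1; rewrite /K1 mulrAC ltr_pdivrMr ?exprn_gt0// mul1r expr_div_n.
      rewrite ltr_pdivlMr ?exprn_gt0 ?ltr0n//.
      by have -> : 16 ^+ 2 = 256 :> R by [ring]; rewrite mulrC.
    rewrite -[X in _ < X]sqrrN => Hd; rewrite ltNge; apply/negP => dN.
    move: Hd; apply/negP; rewrite -leNgt -[leRHS]sqrrN [leLHS]sqrrN.
    by rewrite lerXn2r ?nnegrE ?divr_ge0 ?ler0n//; lra.
  have gainE : \sum_(i <- s) gain u b x i = dev x + mean 0 (fun y => u.[cos y] * cos y) * N%:R.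
    rewrite -(sumw x) mulr_sumr -big_split /=; apply: eq_bigr => j _.
    by rewrite /deviation subrK.
  have PN : N%:R / 8 <= P.
    apply: le_trans Hk; rewrite gainE -/(lossN x).
    have := ucos 0; set al := mean 0 _ => al4.
    have : 4^-1 * N%:R <= al * N%:R by rewrite ler_pM2r.
    have : N%:R * (K2 * lossN x) <= N%:R * 1 by rewrite ler_pM2l// ltW.
    by rewrite /K2; lra.
  apply: (@lt_le_trans _ _ ((kappa * P) ^+ 2)); last by rewrite -PE /nq lerDl sqr_ge0.
  rewrite exprMn kappa2.
  have PN2 : (N%:R / 8) ^+ 2 <= P ^+ 2.
    by rewrite lerXn2r ?nnegrE ?divr_ge0 ?ler0n// (le_trans _ PN)// divr_ge0 ?ler0n.
  apply: (@lt_le_trans _ _ (eps / N%:R * (N%:R / 8) ^+ 2)); last first.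
    by rewrite ler_wpM2l// divr_ge0 ?(ltW eps0)// ltW.
  have -> : eps / N%:R * (N%:R / 8) ^+ 2 = eps * N%:R / 64.
    by field; rewrite gt_eqF.
  rewrite ltr_pdivlMr ?ltr0n//; lra.
have Hmono k k' : (k <= k')%N -> (H k `<=` H k')%fset.
  move=> kk'; apply/fsubsetP => m /bigfcupP[j /andP[js _] mj]; apply/bigfcupP.
  exists j => //; rewrite andbT; move: js.
  by rewrite -{1}(minn_idPl kk') take_min => /mem_take.
have Hsize k : (H k `<=` H (size s))%fset.
  apply/fsubsetP => m /bigfcupP[j /andP[/mem_take js _] mj]; apply/bigfcupP.
  by exists j => //; rewrite take_size js.
exists (Block c H (size s) (\max_(m <- H (size s)) `|m|%N).+1
  (fun x => K1 * dev x ^+ 2 + K2 * lossN x)).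
split => //=.
- split=> [|k|k]; [by rewrite /H take0 big_nil|exact: Hmono|exact: Hsize].
- move=> m mH; have mle : (`|m| <= \max_(m <- H (size s)) `|m|)%N by exact: leq_bigmax_seq.
  move/bigfcupP: (mH) => [j /andP[/mem_take js _] /(window _ _ js)/andP[m3 _]].
  by have := b_ge j; move: mle m3; set M := (\max_(_ <- _) _)%N; clear; lia.
- split.
  + by apply: contD; apply: contZ => //; exact: contX.
  + by move=> x; rewrite addr_ge0// mulr_ge0 ?sqr_ge0// ltW.
  + move=> a; rewrite meanD; [|by apply: contZ; exact: contX|exact: contZ].
    rewrite !meanZ//; last exact: contX.
    by apply: le_trans Keps; apply: lerD; rewrite ler_pM2l.
- move=> x Zx; apply: good.
    by apply: le_lt_trans Zx; rewrite lerDl mulr_ge0// ltW.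
  by apply: le_lt_trans Zx; rewrite lerDr mulr_ge0 ?sqr_ge0// ltW.
Qed.

End blocks.

(** * Concatenation of blocks *)

Section assembling.
Variable R : realType.
Local Notation mu := (@lebesgue_measure R).

(** In a period, the points bad for all s >= n lie in each single bad set beyond [n], whose measure
    is at most 2 pi times [eps s] by Markov. *)
Lemma negligible_liminf_bad (Z : nat -> R -> R) (eps : nat -> R) :
  (forall s, continuous (Z s)) -> (forall s x, 0 <= Z s x) ->
  (forall s a, mean a (Z s) <= eps s) ->
  (forall e, 0 < e -> exists n, forall s, (n <= s)%N -> eps s <= e) ->
  mu.-negligible [set x | exists n, forall s, (n <= s)%N -> 1 <= Z s x].
Proof.
move=> cZ Z0 mZ epsto0; apply: negligible_periods => a.
pose I : set R := `[a, a + 2 * pi]%classic.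
pose V s := I `&` [set x | 1 <= Z s x].
have mV s : measurable (V s).
  apply: measurableI; [exact: measurable_itv|exact: (measurable_superlevel 1 (cZ s))].
have muV s : (mu (V s) <= (2 * pi * eps s)%:E)%E.
  apply: le_trans (markov_mean a (cZ s) (Z0 s) ltr01) _.
  by rewrite lee_fin divr1 ler_wpM2l ?mulr_ge0 ?pi_ge0.
pose A n := \bigcap_s V (n + s)%N.
have mA n : measurable (A n) by apply: bigcap_measurable => //; exists 0%N.
have muA n : mu (A n) = 0%E.
  apply/eqP; rewrite -measure_le0; apply/lee_addgt0Pr => e e0; rewrite add0e.
  have pi2 : 0 < 2 * pi :> R by rewrite mulr_gt0 ?pi_gt0.
  have [k Hk] := epsto0 (e / (2 * pi)) (divr_gt0 e0 pi2).
  apply: (@le_trans _ _ (mu (V (n + k)%N))).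
    by apply: le_measure; rewrite ?inE; [exact: mA|exact: mV|exact: bigcap_inf].
  apply: le_trans (muV _) _; rewrite lee_fin mulrC -ler_pdivlMr//.
  by apply: Hk; rewrite leq_addl.
have sub : [set x | exists n, forall s, (n <= s)%N -> 1 <= Z s x] `&` I `<=` \bigcup_n A n.
  by move=> x [[n Hn] Ix]; exists n => // s _; split => //; apply: Hn; rewrite leq_addr.
apply: (@negligibleS _ _ _ mu _ _ sub); apply: negligible_bigcup => n.
by exists (A n); split; [exact: mA|exact: muA|].
Qed.

Section concatenation.
Variables (eps : nat -> R) (L0 : nat) (blk : nat * nat -> block R).
Hypothesis blkP : forall sL, block_spec (eps sL.1) sL.2 (blk sL).

(** Lower bound for the frequencies of block [s]. The maximum with the successor forces strict
    growth whatever [bl_end] is. *)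
Fixpoint start (s : nat) : nat :=
  if s is s'.+1 then maxn (start s').+1 (bl_end (blk (s', start s'))) else L0.

Local Notation Bk s := (blk (s, start s)).
Local Notation H s := (bl_chain (Bk s)).
Local Notation len s := (bl_len (Bk s)).
Local Notation T s := (H s (len s)).

Lemma start_lt s s' : (s < s')%N -> (start s < start s')%N.
Proof.
elim: s' => // s' IH; rewrite ltnS leq_eqVlt => /orP[/eqP ->|/IH]; first by rewrite /= leq_max ltnSn.
by move=> /ltn_trans; apply; rewrite /= leq_max ltnSn.
Qed.

Lemma start_ge s : (s <= start s)%N.
Proof. by elim: s => // s IH; rewrite /= leq_max ltnS IH. Qed.

Lemma block_freq s m : m \in T s -> (start s)%:Z < m < (start s.+1)%:Z.
Proof.
have [_ win _ _ _] := blkP (s, start s); move=> /win /andP[-> mlt] /=.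
by apply: lt_le_trans mlt _; rewrite lez_nat leq_max leqnn orbT.
Qed.

Lemma block_disjoint s s' m : m \in T s -> m \in T s' -> s = s'.
Proof.
move=> /block_freq /andP[a1 a2] /block_freq /andP[b1 b2].
have lt_abs i j : (i < j)%N -> (start i.+1 <= start j)%N.
  by rewrite leq_eqVlt => /orP[/eqP <-//|/start_lt/ltnW].
have [/lt_abs|/lt_abs|//] := ltngtP s s'; rewrite -lez_nat => h.
  by have := lt_le_trans a2 h => /(lt_trans b1); rewrite ltxx.
by have := lt_le_trans b2 h => /(lt_trans a1); rewrite ltxx.
Qed.

Fixpoint past (s : nat) : {fset int} := if s is s'.+1 then (past s' `|` T s')%fset else fset0.

Lemma pastP s m : reflect (exists2 i, (i < s)%N & m \in T i) (m \in past s).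
Proof.
apply: (iffP idP).
  elim: s => [|s IH] /=; first by rewrite inE.
  by rewrite inE => /orP[/IH[i /ltnW ? ?]|?]; [exists i|exists s].
move=> [i is_ mi]; elim: s is_ => // s IH; rewrite ltnS leq_eqVlt inE => /orP[/eqP <-|/IH ->//].
by rewrite mi orbT.
Qed.

(** Pairs (block, position in its chain) in lexicographic order. Passing to the next block loses
    nothing, since a completed chain enters [past]. *)
Definition next (p : nat * nat) : nat * nat :=
  if (p.2 < len p.1)%N then (p.1, p.2.+1) else (p.1.+1, 0%N).
Definition clock (t : nat) : nat * nat := iter t next (0%N, 0%N).
Definition gather (p : nat * nat) : {fset int} := (past p.1 `|` H p.1 p.2)%fset.

Lemma chain0 s : H s 0 = fset0.
Proof. by have [[]] := blkP (s, start s). Qed.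

Lemma chainS s k : (H s k `<=` H s k.+1)%fset.
Proof. by have [[_ + _] _ _ _ _] := blkP (s, start s). Qed.

Lemma chain_top s k : (H s k `<=` T s)%fset.
Proof. by have [[_ _ +] _ _ _ _] := blkP (s, start s). Qed.

Lemma gather_next p : (gather p `<=` gather (next p))%fset.
Proof.
case: p => s k; rewrite /next /gather /=; case: ltnP => _ /=.
  by apply: fsetUS; exact: chainS.
apply: fsubset_trans (fsubsetUl _ _) => /=.
by apply: fsetUS; exact: chain_top.
Qed.

Lemma clock_reaches s k : (k <= len s)%N -> exists2 t, (s <= t)%N & clock t = (s, k).
Proof.
have from0 t : clock t = (s, 0%N) -> forall j, (j <= len s)%N -> clock (j + t) = (s, j).
  move=> t0; elim=> [|j IH] jl; first exact: t0.
  by rewrite addSn /clock iterS -/(clock (j + t)) IH ?(ltnW jl)// /next /= jl.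
suff [t st ct] : exists2 t, (s <= t)%N & clock t = (s, 0%N).
  move=> kl; exists (k + t)%N; last exact: from0.
  by rewrite (leq_trans st)// leq_addl.
clear from0 k; elim: s => [|s [t st ct]]; first by exists 0%N.
have from0 j : (j <= len s)%N -> clock (j + t) = (s, j).
  elim: j => [|j IH] jl; first exact: ct.
  by rewrite addSn /clock iterS -/(clock (j + t)) IH ?(ltnW jl)// /next /= jl.
exists (len s + t).+1; first by rewrite ltnS (leq_trans st)// leq_addl.
by rewrite /clock iterS -/(clock (len s + t)) from0// /next /= ltnn.
Qed.

Lemma gather_freq p m : m \in gather p -> L0%:Z < m.
Proof.
case: p => s k; rewrite inE /= => mp.
have [i mi] : exists i, m \in T i.
  by case/orP: mp => [/pastP[i _ mi]|/(fsubsetP (chain_top s k)) mk]; [exists i|exists s].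
have /andP[+ _] := block_freq mi; apply: le_lt_trans; rewrite lez_nat.
by clear mi; elim: i => // i IH; rewrite /= leq_max (leq_trans IH)// .
Qed.

Lemma concatenated_coef : exists c : int -> R[i],
  (forall s m, m \in T s -> c m = bl_coef (Bk s) m) /\
  (forall m, (forall s, m \notin T s) -> c m = 0).
Proof.
have /choice[c cP] : forall m, exists z : R[i],
    (forall s, m \in T s -> z = bl_coef (Bk s) m) /\ ((forall s, m \notin T s) -> z = 0).
  move=> m; have [[s ms]|ns] := pselect (exists s, m \in T s).
    exists (bl_coef (Bk s) m); split=> [s' ms'|/(_ s)]; last by rewrite ms.
    by rewrite (block_disjoint ms ms').
  by exists 0; split => // s ms; case: ns; exists s.
by exists c; split=> [s m|m]; have [] := cP m; auto.
Qed.

Variable c : int -> R[i].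
Hypothesis cT : forall s m, m \in T s -> c m = bl_coef (Bk s) m.
Hypothesis c0 : forall m, (forall s, m \notin T s) -> c m = 0.

Lemma past_disjoint s m : m \in past s -> m \notin T s.
Proof.
move=> /pastP[i is_ mi]; apply/negP => ms.
by move: is_; rewrite (block_disjoint mi ms) ltnn.
Qed.

Lemma trig_sum_gather s k x : trig_sum c (gather (s, k)) x =
  trig_sum c (past s) x + trig_sum (bl_coef (Bk s)) (H s k) x.
Proof.
rewrite /trig_sum sum_fsetU /=; last first.
  by move=> m /past_disjoint; apply: contra => /(fsubsetP (chain_top s k)).
congr (_ + _); rewrite big_seq [RHS]big_seq; apply: eq_bigr => m mH.
by rewrite (cT (s := s))//; exact: (fsubsetP (chain_top s k)).
Qed.

Lemma mass_past s : mass c (past s) <= \sum_(i < s) eps i.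
Proof.
elim: s => [|s IH]; first by rewrite big_ord0 /mass big_seq_fset0.
rewrite big_ord_recr /= /mass sum_fsetU; last exact: past_disjoint.
apply: lerD => //; have [_ _ + _ _] := blkP (s, start s); apply: le_trans.
rewrite /mass le_eqVlt; apply/orP; left; apply/eqP.
by rewrite big_seq [RHS]big_seq; apply: eq_bigr => m mT; rewrite (cT mT).
Qed.

Lemma mass_concat (E : {fset int}) (B : R) : (forall s, \sum_(i < s) eps i <= B) -> mass c E <= B.
Proof.
(* A frequency of block [i] exceeds [start i] >= i, so every element of [E] with nonzero coefficient
   lies in the first [s] blocks. *)
move=> epsB; have [s Es] : exists s, forall m, m \in E -> (`|m| < s)%N.
  by exists (\max_(m <- E) `|m|%N).+1 => m mE; rewrite ltnS leq_bigmax_seq.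
apply: le_trans (epsB s); apply: le_trans (mass_past s).
rewrite (massID c E (fun m => m \in past s)) -[leRHS]addr0; apply: lerD.
  rewrite -subr_ge0 -mass_fsetD ?mass_ge0//.
  by apply/fsubsetP => m; rewrite !inE => /andP[].
rewrite /mass big_seq big1// => m; rewrite !inE => /andP[mE mp].
rewrite c0 ?nq0// => i; apply/negP => mi; move/negP: mp; apply; apply/pastP.
exists i => //; have /andP[+ _] := block_freq mi.
have := Es _ mE; have := start_ge i; set S := start i.
by clear; lia.
Qed.

(** The sums gathered at (s, k) and (s, 0) differ by a partial sum of block [s]. A point good for
    infinitely many blocks thus violates the Cauchy criterion at level 1. *)
Lemma ae_not_ccvg : (forall e, 0 < e -> exists n, forall s, (n <= s)%N -> eps s <= e) ->
  {ae mu, forall x : R, ~ ccvg (fun t => trig_sum c (gather (clock t)) x)}.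
Proof.
move=> epsto0.
have Hbad := @negligible_liminf_bad (fun s => bl_bad (Bk s)) eps.
have {}Hbad := Hbad (fun s => let: And5 _ _ _ (And3 a _ _) _ := blkP (s, start s) in a).
have {}Hbad := Hbad (fun s => let: And5 _ _ _ (And3 _ a _) _ := blkP (s, start s) in a).
have {}Hbad := Hbad (fun s => let: And5 _ _ _ (And3 _ _ a) _ := blkP (s, start s) in a).
apply: (@negligibleS _ _ _ mu _ _ _ (Hbad epsto0)) => x /= /contrapT.
move=> /(ccvg_cauchy ltr01)[n Hn]; exists n => s ns; rewrite leNgt; apply/negP => Z1.
have [_ _ _ _ /(_ x Z1)[k kl]] := blkP (s, start s).
apply/negP; rewrite -leNgt; apply: ltW.
have [t st ct] := clock_reaches kl; have [t0 st0 ct0] := clock_reaches (leq0n (len s)).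
have := Hn t t0 (leq_trans ns st) (leq_trans ns st0); rewrite ct ct0 !trig_sum_gather.
by rewrite chain0 [X in _ - (_ + X)]/trig_sum big_seq_fset0 addr0 addrC addKr.
Qed.

End concatenation.

Lemma divergent_trig_series (L0 : nat) : exists (c : int -> R[i]) (G : nat -> {fset int}),
  [/\ forall k, (G k `<=` G k.+1)%fset, forall k m, m \in G k -> L0%:Z < m,
      forall E, mass c E <= 1 &
      {ae mu, forall x : R, ~ ccvg (fun k => trig_sum c (G k) x)}].
Proof.
(* Total at most 1 for the square summability, limit 0 for the bad sets. *)
pose eps s : R := 2^-1 ^+ s.+1.
have eps0 s : 0 < eps s by rewrite exprn_gt0// invr_gt0.
have /choice[blk blkP] : forall sL : nat * nat, exists B, block_spec (eps sL.1) sL.2 B.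
  by move=> sL; exact: block_exists.
have [c [cT c0]] := concatenated_coef L0 blkP.
exists c, (fun k => gather L0 blk (clock L0 blk k)); split.
- by move=> k; exact: (gather_next L0 blkP).
- by move=> k m; exact: (gather_freq blkP).
- move=> E; apply: (mass_concat blkP cT c0) => s.
  suff -> : \sum_(i < s) eps i = 1 - 2^-1 ^+ s by rewrite gerBl exprn_ge0.
  elim: s => [|s IH]; first by rewrite big_ord0 expr0 subrr.
  by rewrite big_ord_recr /= IH /eps exprS; field.
- apply: (ae_not_ccvg blkP cT) => e e0.
  have h : 0 <= e^-1 by rewrite invr_ge0 ltW.
  exists (Num.bound e^-1) => s ns; rewrite /eps exprVn -[leRHS]invrK.
  rewrite lef_pV2 ?posrE ?invr_gt0 ?exprn_gt0//.
  apply: (le_trans (ltW (archi_boundP h))); rewrite -natrX ler_nat.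
  by apply: (leq_trans ns); rewrite ltnW// (ltn_trans _ (ltn_expl _ _)).
Qed.

End assembling.

(** * The critical sequence *)

Section critical_sequence.
Variables (R : realType) (p : nat).
Hypothesis p_gt0 : (0 < p)%N.
Let l := p.+1.
Let lam : R := critical_ratio R l.

Let lam_ge1 : 1 <= lam. Proof. exact: critical_ratio_ge1. Qed.
Let lam_gt0 : 0 < lam. Proof. exact: lt_le_trans lam_ge1. Qed.

Definition lac_step (x : nat) : nat := (Num.truncn (lam * x%:R)).+1.

Lemma lac_step_bounds x : lam * x%:R < (lac_step x)%:R <= lam * x%:R + 1.
Proof.
have h : 0 <= lam * x%:R by rewrite mulr_ge0// ltW.
by have /andP[h1 h2] := truncn_itv h; rewrite h2 /lac_step -natr1 lerD2r.
Qed.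

(** This term minus the [p] preceding ones is q + l^2 + 1, so each integer beyond l^2 is reached by
    one group. The margin l^2 + 1 absorbs the rounding in [lac_step]. *)
Definition last_term (A q : nat) : nat :=
  (\sum_(i < p) iter i lac_step A + (q + (l ^ 2).+1))%N.

(** One step back divides by [lam] with an error of at most lam^-1 <= 1, and earlier errors do not
    grow when divided by [lam]. *)
Lemma iter_lac_step_ge A j i : (i <= j)%N ->
  lam^-1 ^+ i * (iter j lac_step A)%:R - i%:R <= (iter (j - i) lac_step A)%:R :> R.
Proof.
elim: i => [|i IH] ij; first by rewrite expr0 mul1r subr0 subn0.
have lamV1 : lam^-1 <= 1 by rewrite invf_le1.
have lamV0 : 0 < lam^-1 by rewrite invr_gt0.
set y := (iter (j - i.+1) lac_step A).
have e : (j - i = (j - i.+1).+1)%N by lia.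
have := IH (ltnW ij); rewrite e iterS -/y => {}IH.
have /andP[_ sy] := lac_step_bounds y.
have : lam^-1 * (lam^-1 ^+ i * (iter j lac_step A)%:R - i%:R) <= lam^-1 * (lam * y%:R + 1).
  by rewrite ler_pM2l// (le_trans IH).
have -> : lam^-1 * (lam * y%:R + 1) = y%:R + lam^-1 by field; rewrite gt_eqF.
rewrite mulrBr mulrA -exprS.
have : lam^-1 * i%:R <= i%:R by rewrite ler_piMl.
rewrite -[i.+1%:R]natr1; lra.
Qed.

(* The terms before [last_term] grow by the factor [lam] up to rounding, and
   [1 + lam^-1 + ... + lam^-(p - 1) = lam], so their sum is [lam] times the last
   of them up to an error less than [l ^ 2]. *)
Lemma last_term_gt A q : lam * (iter p.-1 lac_step A)%:R < (last_term A q)%:R.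
Proof.
set a := iter p.-1 lac_step A.
have g := geom_critical R (p_gt0 : (2 <= l)%N).
have lamE : \sum_(i < p) lam^-1 ^+ i = lam.
  rewrite -[RHS]mulr1 -g /geom mulr_sumr; apply: eq_bigr => i _.
  by rewrite exprS mulrA mulfV ?gt_eqF// mul1r.
have low : lam * a%:R - p%:R * p%:R <= (\sum_(i < p) iter i lac_step A)%:R.
  rewrite (reindex_inj rev_ord_inj) /= natr_sum.
  apply: (@le_trans _ _ (\sum_(i < p) (lam^-1 ^+ i * a%:R - p%:R))).
    by rewrite sumrB -mulr_suml lamE sumr_const card_ord -[p%:R *+ p]mulr_natr lexx.
  apply: ler_sum => i _.
  have ip : (i <= p.-1)%N by have := ltn_ord i; lia.
  have := iter_lac_step_ge A ip; have -> : (p.-1 - i = p - i.+1)%N by have := ltn_ord i; lia.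
  have : (i%:R : R) <= p%:R by rewrite ler_nat ltnW.
  rewrite -/a; lra.
have pl : p%:R * p%:R < (q + (l ^ 2).+1)%:R :> R by rewrite -natrM ltr_nat /l; nia.
by rewrite /last_term natrD; lra.
Qed.

Definition group_term (A q j : nat) : nat :=
  if (j < p)%N then iter j lac_step A else last_term A q.

Fixpoint group_first (q : nat) : nat :=
  if q is q'.+1 then lac_step (last_term (group_first q') q') else 1%N.

Definition critical_seq (k : nat) : nat :=
  group_term (group_first (k %/ l)) (k %/ l) (k %% l).

Lemma critical_seqE q j : (j <= p)%N ->
  critical_seq (q * l + j) = group_term (group_first q) q j.
Proof.
move=> jp; have jl : (j < l)%N by [].
by rewrite /critical_seq divnMDl// divn_small// addn0 modnMDl modn_small.
Qed.

Lemma group_term_gt0 q j : (0 < group_term (group_first q) q j)%N.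
Proof.
rewrite /group_term; case: ifP => _; last by rewrite /last_term; lia.
by case: j => [|j] //=; case: q.
Qed.

Lemma critical_seq_lacunary : lacunary lam critical_seq.
Proof.
split=> k; first exact: group_term_gt0.
rewrite ltr_pdivlMr ?ltr0n; last exact: group_term_gt0.
have kl : (k %% l <= p)%N by rewrite -ltnS ltn_pmod.
rewrite (divn_eq k l); set q := (k %/ l)%N; set j := (k %% l)%N in kl *.
rewrite critical_seqE//; have [jp|jp] := ltnP j p; last first.
  have -> : j = p by lia.
  have -> : (q * l + p).+1 = (q.+1 * l + 0)%N by rewrite /l; lia.
  rewrite critical_seqE// /group_term ltnn p_gt0 /=.
  by case/andP: (lac_step_bounds (last_term (group_first q) q)).
rewrite -addnS critical_seqE// /group_term jp; case: ltnP => jp'.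
  by rewrite iterS; case/andP: (lac_step_bounds (iter j lac_step (group_first q))).
have -> : j = p.-1 by lia.
exact: last_term_gt.
Qed.

Lemma critical_seq_sums (m : int) : (l ^ 2)%:Z < m -> signed_sums critical_seq l m.
Proof.
move=> lm; pose q := (`|m| - (l ^ 2).+1)%N.
(* The whole group [q] is used, read backwards: its last term with sign +, the others with sign
   -. *)
exists (fun j => if j == 0 :> nat then 1 else -1), (fun j => q * l + (p - j))%N.
split.
- by move=> j; case: eqP => _; [left|right].
- move=> i j ij; rewrite ltn_add2l ltn_sub2l//; apply: leq_trans ij _.
  by rewrite -ltnS; exact: ltn_ord j.
- rewrite big_ord_recl /= mul1r subn0.
  rewrite critical_seqE// {1}/group_term ltnn /last_term PoszD.
  have -> : \sum_(i < p) (if bump 0 i == 0%N then 1 else -1) *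
      (critical_seq (q * l + (p - bump 0 i)))%:Z =
      - (\sum_(i < p) iter i lac_step (group_first q))%N%:Z.
    rewrite (big_morph Posz PoszD erefl) [in RHS](reindex_inj rev_ord_inj) -sumrN /=.
    apply: eq_bigr => i _; rewrite mulN1r critical_seqE ?leq_subr//.
    by rewrite /group_term ifT// /bump leq0n add1n; have := ltn_ord i; lia.
  rewrite addrAC subrr add0r; move: lm; rewrite /q; set l2 := (l ^ 2)%N; clear; lia.
Qed.

End critical_sequence.

(** * Almost everywhere divergence at the critical ratio *)

Section divergence.
Variable R : realType.

Lemma mass_square_summable (A : set int) (c : int -> R[i]) (B : R) :
  (forall E, mass c E <= B) -> square_summable A c.
Proof.
move=> cB; apply: (@le_lt_trans _ _ B%:E); last exact: ltry.
apply: ge_ereal_sup => _ [X [finX _] <-].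
rewrite fsbig_finite//= sumEFin lee_fin.
apply: le_trans (cB (fset_set X)); rewrite le_eqVlt; apply/orP; left; apply/eqP.
by apply: eq_bigr => m _; rewrite sqr_normc_nq.
Qed.

Lemma critical_divergence l : (2 <= l)%N ->
  exists (n : nat -> nat) (c : int -> R[i]) (G : nat -> {fset int}),
    [/\ lacunary (critical_ratio R l) n, square_summable (signed_sums n l) c,
        increasing_in (signed_sums n l) G
      & {ae @lebesgue_measure R, forall x : R, ~ ccvg (fun k => trig_sum c (G k) x)}].
Proof.
case: l => [|p] // p0.
have [c [G [Ginc GL cE Gdiv]]] := divergent_trig_series R (p.+1 ^ 2).
exists (critical_seq R p), c, G; split => //.
- exact: critical_seq_lacunary.
- exact: mass_square_summable cE.
- by split=> // k m /GL; exact: critical_seq_sums.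
Qed.

End divergence.

Unset Implicit Arguments.
Set Strict Implicit.

Theorem corollary1p1 (R : realType) (l : nat) (hl : (2 <= l)%N) :
  (forall (lam : R) (n : nat -> nat),
     critical_ratio R l < lam -> lacunary lam n ->
     unconditional_convergence_system (@lebesgue_measure R) `[0, 2 * pi]
       (signed_sums n l) (fun (m : int) (x : R) => expi (m%:~R * x)) /\
     (forall c : int -> R[i], square_summable (signed_sums n l) c ->
      forall G : nat -> {fset int}, increasing_in (signed_sums n l) G ->
      {ae @lebesgue_measure R, forall x : R,
         ccvg (fun k => trig_sum c (G k) x)}))
  /\
  (exists (n : nat -> nat) (c : int -> R[i]) (G : nat -> {fset int}),
     [/\ lacunary (critical_ratio R l) n,
         square_summable (signed_sums n l) c,
         increasing_in (signed_sums n l) G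
       & {ae @lebesgue_measure R, forall x : R,
            ~ ccvg (fun k => trig_sum c (G k) x)}]).
Proof.
split; last exact: critical_divergence.
move=> lam n cl lac; split; first exact: supercritical_ucs cl lac.
exact: supercritical_ae_ccvg cl lac.
Qed.
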